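(* Let $g\in\mathbb Z_{>0}$ and $x=2g+1$. Let $(G,\rho)$ have vertices $v,z,w$, two edges $c_1,c_2$ joining $v$ and $z$, and $x$ edges $f_1,\dots,f_x$ joining $z$ and $w$, where $c_1,c_2$ are consecutive in $\rho_z$ and the restriction of $\rho_z$ to $\{f_1,\dots,f_x\}$ equals $\rho_w$. Let $(G',\rho')$ have the same vertices $v,z,w$, one edge $c$ joining $v$ and $z$, and $2x$ edges $h_1,\dots,h_{2x}$ joining $z$ and $w$, where the restriction of $\rho'_z$ to $\{h_1,\dots,h_{2x}\}$ equals $\rho'_w$. Then: $\operatorname{Pic}^0(G)\cong\operatorname{Pic}^0(G')$; the set $V_{gen}=\{v,w\}$ satisfies Properties 1 and 2 below, so the map $\hat\gamma:\operatorname{Pic}^0(G)\to\operatorname{Pic}^0(G')$ induced by the identity on $V_{gen}$ is an isomorphism; there is a bijection $\varphi:\mathcal T(G)\to\mathcal T(G')$ such that for every vertex $u\in\{v,z,w\}$ and for $\alpha$ either the rotor routing process or the Bernardi process, $\varphi(\alpha_u^{G}(S,T))=\alpha_u^{G'}(\hat\gamma(S),\varphi(T))$ for all $S\in\operatorname{Pic}^0(G)$, $T\in\mathcal T(G)$; and the genus of $(G,\rho)$ is $g$ while the genus of $(G',\rho')$ is $2g$.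
   Context: Graphs are finite, connected, loopless, possibly with multiple edges; $\mathcal T(G)$ is the set of spanning trees. A ribbon graph assigns to each vertex $u$ a cyclic order $\rho_u$ on incident edges. $\operatorname{Pic}^0$ is degree-zero integer chip configurations modulo firings (firing $u$ sends one chip from $u$ along each incident edge); $\operatorname{Pic}^k$ likewise for degree $k$. For graphs $G,G'$ on the same vertex set and $V_{gen}\subseteq V(G)$: Property 1: every element of $\operatorname{Pic}^0(G)$ and of $\operatorname{Pic}^0(G')$ has a representative with no chips outside $V_{gen}$; Property 2: two degree-zero configurations with no chips outside $V_{gen}$ are equivalent in $G$ iff equivalent in $G'$. Then $\hat\gamma(S)$ is the class in $\operatorname{Pic}^0(G')$ of any representative of $S$ supported on $V_{gen}$ (same chip counts). Rotor routing torsor $r_u$: for $S$, $T$, choose a representative of $S$ nonnegative away from $u$; orient $T$ towards $u$ giving each other vertex a rotor; while some vertex $y\ne u$ has positive chips, advance its rotor to the next edge of $\rho_y$ and send a chip along it; when all vertices but $u$ have zero chips, the rotors form $r_u(S,T)$. Bernardi torsor $\beta_u$: with half-edges $(e,y)$, for $T$ start at $(e_0,u)$, $e_0$ a fixed edge at $u$; at $(e',y')$: if $e'\in T$ with other endpoint $y''$, move to $(e'',y'')$ with $e''$ following $e'$ in $\rho_{y''}$; if $e'\notin T$, move to $(\tilde e,y')$ with $\tilde e$ following $e'$ in $\rho_{y'}$, placing a chip on $y'$ if the other half-edge of $e'$ was not yet visited; stop on return to $(e_0,u)$. The resulting divisors $D_T$ of degree $|E|-|V|+1$ are in bijection with $\operatorname{Pic}^{|E|-|V|+1}$,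 and $\beta_u(S,T)$ is the unique $T'$ with $[D_{T'}]=[D_T]+S$. Genus: a cycle is a closed walk which, entering $y$ along $e$, exits along the edge following $e$ in $\rho_y$; the genus $g$ satisfies $2g=2-|V|+|E|-\operatorname{cyc}$, $\operatorname{cyc}$ the number of cycles. *)

(* Defs.v *)
From mathcomp Require Import all_boot all_order perm all_algebra.
Set Implicit Arguments. Unset Strict Implicit. Unset Printing Implicit Defensive.
Import GRing.Theory Num.Theory.
Local Open Scope ring_scope.

Section Multigraph.
Variables (V E : finType) (s t : E -> V).

Definition inc (y : V) (e : E) : bool := (s e == y) || (t e == y).

Definition other (e : E) (y : V) : V := if s e == y then t e else s e.

Definition deg (D : V -> int) : int := \sum_(y : V) D y.

(* D' is obtained from D by an integer combination f of firings
   (firing u sends one chip from u along each incident edge). *)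
Definition lin_equiv (D D' : V -> int) : Prop :=
  exists f : V -> int, forall y : V,
    D' y = D y - \sum_(e : E | inc y e) (f y - f (other e y)).

Definition tadj (T : {set E}) : rel V :=
  fun a b => [exists e in T, ((s e == a) && (t e == b)) || ((t e == a) && (s e == b))].

Definition spanning_tree (T : {set E}) : Prop :=
  #|T| = #|V|.-1 /\ forall a b : V, connect (tadj T) a b.

Definition oriented (T : {set E}) (u : V) (r : V -> E) : Prop :=
  forall y : V, y != u ->
    [/\ r y \in T, inc y (r y) &
        exists n : nat, iter n (fun x => if x == u then u else other (r x) x) y = u].

(* ribbon structure: rho u is a cyclic permutation of the edges at u
   (fixing all other edges); "next edge after e in rho_u" is rho u e. *)
Definition is_ribbon (rho : V -> {perm E}) : Prop :=
  forall u : V,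
    (forall e, ~~ inc u e -> rho u e = e) /\
    (forall e e', inc u e -> inc u e' -> fconnect (rho u) e e').

Definition restrict_succ (p : E -> E) (A : pred E) (e e' : E) : Prop :=
  e' \in A /\ exists k : nat,
    [/\ (0 < k)%N, iter k p e = e' &
        forall j : nat, (0 < j)%N -> (j < k)%N -> iter j p e \notin A].

Variable rho : V -> {perm E}.

Definition rstate := ((V -> int) * (V -> E))%type.

Definition rr_step (u : V) (st st' : rstate) : Prop :=
  exists y : V, [/\ y != u, 0 < st.1 y,
    (forall x, st'.2 x = if x == y then rho y (st.2 y) else st.2 x) &
    (forall x, st'.1 x = st.1 x - (x == y)%:R
                          + (x == other (rho y (st.2 y)) y)%:R)].

Inductive rr_run (u : V) : rstate -> rstate -> Prop :=
| rr_refl st : rr_run u st st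
| rr_next st st' st'' : rr_step u st st' -> rr_run u st' st'' -> rr_run u st st''.

(* T' is r_u(S, T), where S is the class of D *)
Definition rotor_rel (u : V) (D : V -> int) (T T' : {set E}) : Prop :=
  exists (D0 : V -> int) (r0 : V -> E) (D1 : V -> int) (r1 : V -> E),
    [/\ lin_equiv D D0, (forall y, y != u -> 0 <= D0 y) & oriented T u r0] /\
    [/\ rr_run u (D0, r0) (D1, r1), (forall y, y != u -> D1 y = 0),
        spanning_tree T' & oriented T' u r1].

(* half-edges (e, y) with y an endpoint of e; non-incident pairs are fixed *)
Definition bnext (T : {set E}) (h : E * V) : E * V :=
  let: (e, y) := h in
  if ~~ inc y e then h
  else if e \in T then (rho (other e y) e, other e y)
  else (rho y e, y).

(* the tour from (e0,u) up to the first return (the orbit length), and the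
   resulting divisor D_T *)
Definition bern_div (T : {set E}) (e0 : E) (u : V) (y : V) : int :=
  let h0 := (e0, u) in
  let N := order (bnext T) h0 in
  let walk := traject (bnext T) h0 N in
  ((\sum_(i < N)
     [&& (nth h0 walk i).2 == y,
         (nth h0 walk i).1 \notin T &
         ((nth h0 walk i).1, other (nth h0 walk i).1 (nth h0 walk i).2)
            \notin take i walk]) : nat)%:Z.

(* T' = beta_u(S, T), S the class of D: [D_T'] = [D_T] + S *)
Definition bern_rel (u : V) (D : V -> int) (T T' : {set E}) : Prop :=
  spanning_tree T' /\
  forall e0 : E, inc u e0 ->
    lin_equiv (fun y => bern_div T e0 u y + D y) (bern_div T' e0 u).

(* darts (e, y): leave y along e; entering y2 along e, exit along rho y2 e *)
Definition face_next (h : E * V) : E * V :=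
  let: (e, y) := h in
  if inc y e then (rho (other e y) e, other e y) else h.

Definition ncycles : nat := fcard face_next (fun h : E * V => inc h.2 h.1).

Definition twice_genus : int :=
  2 - (#|V| : nat)%:Z + (#|E| : nat)%:Z - (ncycles : nat)%:Z.

End Multigraph.

Definition property1 (V E : finType) (s t : E -> V) (Vgen : pred V) : Prop :=
  forall D : V -> int, deg D = 0 ->
    exists D' : V -> int, lin_equiv s t D D' /\ forall y, y \notin Vgen -> D' y = 0.

Definition property2 (V E E' : finType) (s t : E -> V) (s' t' : E' -> V)
  (Vgen : pred V) : Prop :=
  forall D1 D2 : V -> int, deg D1 = 0 -> deg D2 = 0 ->
    (forall y, y \notin Vgen -> D1 y = 0) -> (forall y, y \notin Vgen -> D2 y = 0) ->
    (lin_equiv s t D1 D2 <-> lin_equiv s' t' D1 D2).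

Definition vv : 'I_3 := @Ordinal 3 0 isT.
Definition zz : 'I_3 := @Ordinal 3 1 isT.
Definition ww : 'I_3 := @Ordinal 3 2 isT.

(* G: x = 2g+1, edges 0,1 are c1,c2 (v--z); edges 2..x+1 are f_i (z--w) *)
Definition EG (g : nat) : finType := 'I_((g.*2.+1).+2).
Definition srcG g (e : EG g) : 'I_3 := if (e < 2)%N then vv else zz.
Definition tgtG g (e : EG g) : 'I_3 := if (e < 2)%N then zz else ww.
Definition c1 g : EG g := @Ordinal ((g.*2.+1).+2) 0 isT.
Definition c2 g : EG g := @Ordinal ((g.*2.+1).+2) 1 isT.
Definition isF g : pred (EG g) := fun e => (2 <= e)%N.

(* G': edge 0 is c (v--z); edges 1..2x are h_i (z--w) *)
Definition EG' (g : nat) : finType := 'I_((g.*2.+1).*2.+1).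
Definition srcG' g (e : EG' g) : 'I_3 := if (e == 0 :> nat) then vv else zz.
Definition tgtG' g (e : EG' g) : 'I_3 := if (e == 0 :> nat) then zz else ww.
Definition isH g : pred (EG' g) := fun e => (0 < e)%N.

Definition Vgen : pred 'I_3 := fun y => (y == vv) || (y == ww).

(* Main.v *)
Require Import Defs.
From mathcomp Require Import all_boot all_order perm all_algebra.
From mathcomp Require Import zify.
Import GRing.Theory Num.Theory.
Local Open Scope ring_scope.

(* Both graphs are paths l - m - r with p edges l - m and q edges m - r, where
   (p, q) is (2, x) for G and (1, 2x) for G', and in both the rotation at m
   runs through all the l-edges and then through all the r-edges, in the order
   used at l and at r. For such a graph a tree is a pair (i, j) in Z/p x Z/q
   and the class of a divisor D is its degree together with (D l, D r) in
   Z/p x Z/q. In these coordinates both torsors are translations: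
     rotor routing:  u = m : (i + D l, j + D r)   u = l : (i - D l, j + D r)
     Bernardi:       u = m : (i - D l, j - D r)   u = l : (i + D l, j - D r)
   and the case u = r follows by exchanging l and r. When D m = 0 and
   deg D = 0 we have D l = - D r, and signs do not matter modulo 2, so for G
   each action is (i, j) |-> (i + s, j + s) with s = D r or s = - D r; by the
   Chinese remainder theorem this is k |-> k + s modulo 2x, the action of G'. *)

Set Implicit Arguments.
Unset Strict Implicit.

(** Both torsors are relations between trees and are compared by equivalences, so each translation
    needs two directions. For rotor routing, a charge preserved by every step fixes the end of any
    run, whatever the order of the firings; conversely a terminating run must be exhibited, from a
    representative that is nonnegative off the root. With root l the last rotor at m must moreover
    point to l: otherwise the rotors at m and r only lead back and forth between these two vertices
    and form no tree. For the Bernardi process, the starting half-edge shifts the divisor by an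
    amount that does not depend on the tree, so it cancels when two trees are compared. That x is
    odd serves twice. It makes 2 and x coprime, and it joins in G the even and odd positions of the
    r-edges into one face, while in G' the even number 2x keeps them in two faces; in G the second
    face is the digon between the two l-edges. *)

(** The quotient is an explicit witness, so that congruences between possibly negative integers are
    combined by adding witnesses and closed by [lia]. *)
Definition modeq (n : nat) (a b : int) : Prop := exists k : int, a = b + k * n%:Z.

Lemma modeqP (n i j : nat) : reflect (modeq n i j) (i == j %[mod n]).
Proof.
have -> : (i == j %[mod n]) = (n %| i%:Z - j%:Z)%Z.
  by rewrite -eqz_mod_dvd !modz_nat eqz_nat.
by apply: (iffP dvdzP) => -[k e]; exists k; lia.
Qed.

Lemma modeq_refl n a : modeq n a a.
Proof. by exists 0; lia. Qed.

Lemma modeq_sym n a b : modeq n a b -> modeq n b a.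
Proof. by case=> k ->; exists (- k); lia. Qed.

Lemma modeq_trans n a b c : modeq n a b -> modeq n b c -> modeq n a c.
Proof. by case=> k -> [k' ->]; exists (k' + k); lia. Qed.

(** * Incidence and rotation in a ribbon graph *)

Section RibbonStep.
Variables (V E : finType) (s t : E -> V) (rho : V -> {perm E}).
Hypothesis ribbon : is_ribbon s t rho.

Lemma inc_rho y e : inc s t y (rho y e) = inc s t y e.
Proof.
have [fixed _] := ribbon y.
apply/idP/idP => [|ie]; first by apply: contraTT => /[dup] ? /fixed ->.
apply: contraTT ie => /[dup] nie /fixed /perm_inj h; by rewrite h in nie.
Qed.

Lemma inc_other y e : inc s t y e -> inc s t (other s t e y) e.
Proof. by rewrite /inc /other; case: eqP; rewrite eqxx ?orbT. Qed.

Lemma otherK y e : inc s t y e -> other s t e (other s t e y) = y.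
Proof.
rewrite /inc /other; case: (s e =P y) => [->|_] /=; last by rewrite eqxx => /eqP.
by case: eqP.
Qed.

Lemma inc_orbit y e : inc s t y e -> orbit (rho y) e =i [pred x | inc s t y x].
Proof.
move=> ie x; rewrite -fconnect_orbit inE; apply/idP/idP => [/iter_findex <-|ix].
  by elim: (findex _ _ _) => //= n IH; rewrite inc_rho.
by have [_] := ribbon y; apply.
Qed.

(** Crossing an edge is an involution on darts and [rho] permutes the edges at a vertex, so the
    image dart determines its source. Injectivity makes connectivity along faces symmetric. *)
Lemma face_next_inj : injective (face_next s t rho).
Proof.
move=> [e y] [e' y']; rewrite /face_next.
case: ifP => i1; case: ifP => i2 [].
- move=> he hy; rewrite -hy in he; have {}he := perm_inj he; subst e'.
  by rewrite -(otherK i1) hy otherK.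
- by move=> he hy; rewrite -he -hy inc_rho inc_other in i2.
- by move=> he hy; rewrite he hy inc_rho inc_other in i1.
- by move=> -> ->.
Qed.

End RibbonStep.

(* A path l - m - r with multiplicities p and q, the edges being indexed so
   that rho m runs through eL 0, ..., eL (p-1), eR 0, ..., eR (q-1) in this
   cyclic order; eL and eR are periodic, of period p and q. *)
Record fat_path (V E : finType) (s t : E -> V) (rho : V -> {perm E})
  (l m r : V) (p q : nat) (eL eR : nat -> E) : Prop := FatPath {
  fp_p : (0 < p)%N;
  fp_q : (0 < q)%N;
  fp_lm : l != m;
  fp_rm : r != m;
  fp_lr : l != r;
  fp_V : forall y, [|| y == l, y == m | y == r];
  fp_endL : forall i, (s (eL i) = l /\ t (eL i) = m) \/ (s (eL i) = m /\ t (eL i) = l);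
  fp_endR : forall i, (s (eR i) = r /\ t (eR i) = m) \/ (s (eR i) = m /\ t (eR i) = r);
  fp_E : forall e, (exists2 i, (i < p)%N & e = eL i) \/ (exists2 j, (j < q)%N & e = eR j);
  fp_eqL : forall i j, (eL i == eL j) = (i == j %[mod p]);
  fp_eqR : forall i j, (eR i == eR j) = (i == j %[mod q]);
  fp_rhol : forall i, rho l (eL i) = eL i.+1;
  fp_rhor : forall i, rho r (eR i) = eR i.+1;
  fp_rhomL : forall i, rho m (eL i) = if (p %| i.+1)%N then eR 0 else eL i.+1;
  fp_rhomR : forall i, rho m (eR i) = if (q %| i.+1)%N then eL 0 else eR i.+1;
  fp_ribbon : is_ribbon s t rho }.

(** The order at m is cyclic, so the l-block followed by the r-block may be read starting from
    either block. Facts about r thus transfer to l. *)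
Lemma fat_path_swap (V E : finType) (s t : E -> V) rho l m r p q eL eR :
  @fat_path V E s t rho l m r p q eL eR -> fat_path s t rho r m l q p eR eL.
Proof.
case=> ? ? ? ? ? HV ? ? HE *; split=> //; first by rewrite eq_sym.
- by move=> y; rewrite orbC -orbA orbCA.
- by move=> e; case: (HE e); [right | left].
Qed.

Section FatPath.
Variables (V E : finType) (s t : E -> V) (rho : V -> {perm E}).
Variables (l m r : V) (p q : nat) (eL eR : nat -> E).
Hypothesis H : fat_path s t rho l m r p q eL eR.

Notation inc := (inc s t).
Notation other := (other s t).

Lemma neq_vertices : ((l == m) = false) * ((m == l) = false) * ((r == m) = false)
  * ((m == r) = false) * ((l == r) = false) * ((r == l) = false).
Proof.
by rewrite [m == l]eq_sym [m == r]eq_sym [r == l]eq_sym !(negbTE (fp_lm H)) !(negbTE (fp_rm H))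
  !(negbTE (fp_lr H)).
Qed.

Lemma inc_eL i y : inc y (eL i) = (y == l) || (y == m).
Proof.
by rewrite /Defs.inc; case: (fp_endL H i) => -[-> ->]; rewrite !(eq_sym y) // orbC.
Qed.

Lemma inc_eR i y : inc y (eR i) = (y == r) || (y == m).
Proof.
by rewrite /Defs.inc; case: (fp_endR H i) => -[-> ->]; rewrite !(eq_sym y) // orbC.
Qed.

Lemma other_eL i : (other (eL i) l = m) * (other (eL i) m = l).
Proof.
by rewrite /Defs.other; case: (fp_endL H i) => -[-> ->]; rewrite !eqxx ?neq_vertices.
Qed.

Lemma other_eR i : (other (eR i) r = m) * (other (eR i) m = r).
Proof.
by rewrite /Defs.other; case: (fp_endR H i) => -[-> ->]; rewrite !eqxx ?neq_vertices.
Qed.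

Lemma inc_m e : inc m e.
Proof. by case: (fp_E H e) => -[i _ ->]; rewrite ?inc_eL ?inc_eR eqxx orbT. Qed.

Lemma inc_r e : inc r e = ~~ inc l e.
Proof.
by case: (fp_E H e) => -[i _ ->]; rewrite ?inc_eL ?inc_eR !eqxx !neq_vertices.
Qed.

Lemma inc_lP e : inc l e -> exists2 i, (i < p)%N & e = eL i.
Proof. by case: (fp_E H e) => // -[i _ ->]; rewrite inc_eR !neq_vertices. Qed.

Lemma other_l e : inc l e -> other e l = m.
Proof. by case/inc_lP => i _ ->; rewrite other_eL. Qed.

Lemma other_m e : other e m = if inc l e then l else r.
Proof.
case: (fp_E H e) => -[i _ ->]; rewrite ?other_eL ?other_eR ?inc_eL ?inc_eR ?eqxx //.
by rewrite !neq_vertices.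
Qed.

Lemma eL_eq_modeq i j : eL i = eL j <-> modeq p i j.
Proof. by rewrite (rwP eqP) (fp_eqL H); split=> /modeqP. Qed.

Lemma card_inc_l : #|[pred e | inc l e]| = p.
Proof.
have iE : injective (fun i : 'I_p => eL i).
  by move=> i j /eqP; rewrite (fp_eqL H) !modn_small // => /eqP; apply: val_inj.
rewrite -[RHS]card_ord -(card_codom iE); apply: eq_card => e; rewrite !inE.
apply/idP/codomP => [/inc_lP[i ip ->]|[i ->]]; first by exists (Ordinal ip).
by rewrite inc_eL eqxx.
Qed.

Lemma sum_V (R : nmodType) (F : V -> R) : \sum_y F y = F l + F m + F r.
Proof.
rewrite (bigD1 l) //= (bigD1 m) ?neq_vertices //= (bigD1 r) ?neq_vertices //=.
rewrite big1 ?addr0 ?addrA // => y; have := fp_V H y.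
by case: (y == l) (y == m) (y == r) => [] [] [].
Qed.

Lemma card_V : #|V| = 3.
Proof.
rewrite -sum1_card (bigD1 l) //= (bigD1 m) ?neq_vertices //= (bigD1 r) ?neq_vertices //=.
rewrite big1 // => y; have := fp_V H y.
by case: (y == l) (y == m) (y == r) => [] [] [].
Qed.

End FatPath.

(** * Divisor classes and spanning trees in coordinates *)

Section FatPathPic.
Variables (V E : finType) (s t : E -> V) (rho : V -> {perm E}).
Variables (l m r : V) (p q : nat) (eL eR : nat -> E).
Hypothesis H : fat_path s t rho l m r p q eL eR.

Let H' := fat_path_swap H.

Lemma card_E : #|E| = (p + q)%N.
Proof.
rewrite -(card_inc_l H) -(card_inc_l H') -(cardC [pred e | inc s t l e]).
by congr (_ + _)%N; apply: eq_card => e; rewrite !inE (inc_r H).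
Qed.

Lemma fires_l (f : V -> int) :
  \sum_(e | inc s t l e) (f l - f (other s t e l)) = p%:Z * (f l - f m).
Proof.
rewrite (eq_bigr (fun=> f l - f m)) => [|e ie]; last by rewrite (other_l H).
by rewrite sumr_const (card_inc_l H) -mulr_natl // natz.
Qed.

Lemma fires_r (f : V -> int) :
  \sum_(e | inc s t r e) (f r - f (other s t e r)) = q%:Z * (f r - f m).
Proof.
rewrite (eq_bigr (fun=> f r - f m)) => [|e ie]; last by rewrite (other_l H').
by rewrite sumr_const (card_inc_l H') -mulr_natl natz.
Qed.

Lemma fires_m (f : V -> int) :
  \sum_(e | inc s t m e) (f m - f (other s t e m))
    = p%:Z * (f m - f l) + q%:Z * (f m - f r).
Proof.
rewrite (bigID (inc s t l)) /=; congr (_ + _).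
  rewrite (eq_big (inc s t l) (fun=> f m - f l)) => [||e /andP[_ ie]].
  - by rewrite sumr_const (card_inc_l H) -mulr_natl natz.
  - by move=> e; rewrite (inc_m H).
  - by rewrite (other_m H) ie.
rewrite (eq_big (inc s t r) (fun=> f m - f r)) => [||e /andP[_ /negbTE ie]].
- by rewrite sumr_const (card_inc_l H') -mulr_natl natz.
- by move=> e; rewrite (inc_m H) (inc_r H).
- by rewrite (other_m H) ie.
Qed.

(** Firings change the chips at l by multiples of p and those at r by multiples of q, independently
    of each other; the degree then determines the chips at m. *)
Lemma lin_equivP (D D' : V -> int) :
  lin_equiv s t D D' <->
  [/\ deg D' = deg D, modeq p (D' l) (D l) & modeq q (D' r) (D r)].
Proof.
rewrite /deg !(sum_V H); split=> [[f Hf]|[hd [a ha] [b hb]]].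
  rewrite !Hf fires_l fires_m fires_r; split; first by lia.
  - by exists (f m - f l); lia.
  - by exists (f m - f r); lia.
(* Only f m - f l and f m - f r matter, so f m is normalised to 0. *)
pose f y := if y == l then - a else if y == r then - b else 0.
have fE : [/\ f l = - a, f m = 0 & f r = - b] by rewrite /f !eqxx !(neq_vertices H).
case: fE => fl fm fr; exists f => y.
by case/or3P: (fp_V H y) => /eqP->; rewrite ?fires_l ?fires_m ?fires_r ?fl ?fm ?fr; lia.
Qed.

Lemma tadj_inc (T : {set E}) a b : tadj s t T a b -> exists2 e, e \in T & inc s t a e.
Proof.
case/existsP => e /andP[eT h]; exists e => //.
by case/orP: h => /andP[h _]; rewrite /inc h ?orbT.
Qed.

Lemma spanning_tree_inc (T : {set E}) a :
  spanning_tree s t T -> exists2 e, e \in T & inc s t a e.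
Proof.
case=> _ conn.
have [b ab] : exists b, b != a.
  by case: (altP (l =P a)) => [<-|]; [exists m; rewrite eq_sym (fp_lm H) | exists l].
case/connectP: (conn a b) => -[/= _ e|c pth /= /andP[/tadj_inc h _] _ //].
by rewrite e eqxx in ab.
Qed.

Lemma tadj_sym T a b : tadj s t T a b = tadj s t T b a.
Proof.
by apply: eq_existsb => e; rewrite [X in _ && X]orbC ![(t e == a) && _]andbC ![(s e == a) && _]andbC.
Qed.

(** Connectedness forces a tree edge at l and one at r. They differ, and a tree has only two
    edges. *)
Lemma tree_coordsP (T : {set E}) : spanning_tree s t T <->
  exists i j, T = [set eL i; eR j].
Proof.
split=> [st|[i [j ->]]].
  have [e eT /(inc_lP H) [i _ ei]] := spanning_tree_inc l st.
  have [e' eT' /(inc_lP H') [j _ ej]] := spanning_tree_inc r st.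
  exists i, j; case: st => cT _; rewrite (card_V H) /= in cT.
  apply/esym/eqP; rewrite eqEcard cT subUset !sub1set -ei -ej eT eT' /= ei ej cards2.
  have -> // : eL i != eR j.
  apply/eqP => h; have := inc_eL H i l; by rewrite h (inc_eR H) !(neq_vertices H) eqxx.
have nLR : eL i != eR j.
  apply/eqP => h; have := inc_eL H i l; by rewrite h (inc_eR H) !(neq_vertices H) eqxx.
split; first by rewrite (card_V H) cards2 nLR.
set T0 := [set _; _].
have ts : connect_sym (tadj s t T0) by apply: sym_connect_sym => a b; apply: tadj_sym.
have lm : tadj s t T0 l m.
  apply/existsP; exists (eL i); rewrite !inE eqxx /=.
  by case: (fp_endL H i) => -[-> ->]; rewrite !eqxx ?orbT.
have rm : tadj s t T0 r m.
  apply/existsP; exists (eR j); rewrite !inE eqxx orbT /=.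
  by case: (fp_endR H j) => -[-> ->]; rewrite !eqxx ?orbT.
have cm y : connect (tadj s t T0) y m.
  by case/or3P: (fp_V H y) => /eqP ->; [apply: connect1| apply: connect0| apply: connect1].
move=> a b; apply: connect_trans (cm a) _.
by rewrite ts; apply: cm.
Qed.

End FatPathPic.

(** * Rotor routing *)

(* k+1 for the edge e k, and 0 for an edge not among e 0, ..., e (n-1): modulo
   n, the number of those edges that a rotor turning at m from the edge before
   e 0 has passed. *)
Definition turn (E : eqType) (n : nat) (e : nat -> E) (x : E) : nat :=
  if (index x (mkseq e n) < n)%N then (index x (mkseq e n)).+1 else 0.

Section Turn.
Variables (V E : finType) (s t : E -> V) (rho : V -> {perm E}).
Variables (l m r : V) (p q : nat) (eL eR : nat -> E).
Hypothesis H : fat_path s t rho l m r p q eL eR.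

Let H' := fat_path_swap H.

Lemma turn_small j : (j < q)%N -> turn q eR (eR j) = j.+1.
Proof.
move=> jq; rewrite /turn.
have -> : index (eR j) (mkseq eR q) = j; last by rewrite jq.
rewrite -(nth_mkseq (eR j) eR jq) index_uniq ?size_mkseq //.
by apply/mkseq_uniqP => i k iq kq /eqP; rewrite (fp_eqR H) !modn_small // => /eqP.
Qed.

Lemma turn_eL i : turn q eR (eL i) = 0%N.
Proof.
rewrite /turn ifF // -[X in (_ < X)%N](size_mkseq eR q) index_mem.
apply/negP => /mapP[j _ h]; have := inc_eL H i l.
by rewrite h (inc_eR H) !(neq_vertices H) eqxx.
Qed.

Lemma eR_mod j : eR (j %% q) = eR j.
Proof. by apply/eqP; rewrite (fp_eqR H) modn_mod. Qed.

Lemma turn_eR j : modeq q (turn q eR (eR j)) j.+1.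
Proof.
rewrite -eR_mod turn_small ?ltn_mod ?(fp_q H) //.
by apply/modeqP; rewrite -!(addn1 (_ %% _)) -[j.+1]addn1 modnDml.
Qed.

(** The only drop occurs when the rotor leaves the r-block: [turn] falls from q to 0, which is
    invisible modulo q. *)
Lemma turn_rho_m e :
  modeq q (turn q eR (rho m e)) (turn q eR e + inc s t r (rho m e))%N.
Proof.
case: (fp_E H e) => -[i ip ->].
  rewrite (fp_rhomL H) turn_eL; case: ifP => _.
    by rewrite turn_small ?(fp_q H) // (inc_eR H) eqxx; exists 0; lia.
  by rewrite turn_eL (inc_eL H) !(neq_vertices H); exists 0; lia.
rewrite (fp_rhomR H) (turn_small ip); case: ifP => [|nd].
  rewrite turn_eL (inc_eL H) !(neq_vertices H) => /dvdnP[k e0].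
  by exists (- k%:Z); lia.
rewrite turn_small ?(inc_eR H) ?eqxx; first by exists 0; lia.
by rewrite ltn_neqAle ip andbT; apply: contraFneq nd => ->.
Qed.

Lemma turn_rho_r e : inc s t r e ->
  modeq q (turn q eR (rho r e)) (turn q eR e + 1)%N.
Proof.
case/(inc_lP H') => i iq ->; rewrite (fp_rhor H) (turn_small iq) addn1.
exact: turn_eR.
Qed.

(* The number of chips that the rotor at m still sends to r before the next
   one goes to l. *)
Definition delay e : nat :=
  if inc s t l e then (if inc s t r (rho m e) then q else 0) else (q - turn q eR e)%N.

Lemma delay_le e : (delay e <= q)%N.
Proof. by rewrite /delay; case: ifP => _; [case: ifP | rewrite leq_subr]. Qed.

(** Each chip sent from m to r uses up one unit of [delay], which makes it a termination measure. *)
Lemma delay_rho_m e : inc s t r (rho m e) -> delay e = (delay (rho m e)).+1.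
Proof.
move=> ir; have nl : inc s t l (rho m e) = false by move: ir; rewrite (inc_r H) => /negbTE.
rewrite /delay nl ir {nl}; move: ir.
have q0 := fp_q H.
case: (fp_E H e) => -[i ip ->].
  rewrite (fp_rhomL H) (inc_eL H) eqxx /=; case: ifP => _ ir.
    by rewrite turn_small //; lia.
  by rewrite (inc_eL H) !(neq_vertices H) in ir.
rewrite (fp_rhomR H) (inc_eR H) !(neq_vertices H) /=; case: ifP => [_|nd] ir.
  by rewrite (inc_eL H) !(neq_vertices H) in ir.
have iq : (i.+1 < q)%N.
  by rewrite ltn_neqAle ip andbT; apply: contraFneq nd => ->.
by rewrite !turn_small //; lia.
Qed.

End Turn.

Section Rotor.
Variables (V E : finType) (s t : E -> V) (rho : V -> {perm E}).
Variables (l m r : V) (p q : nat) (eL eR : nat -> E).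
Hypothesis H : fat_path s t rho l m r p q eL eR.

Let H' := fat_path_swap H.

Definition rotors_inc (u : V) (rt : V -> E) := forall y, y != u -> inc s t y (rt y).

Definition rotor_charge (st : rstate V E) : int :=
  st.1 r + (turn q eR (st.2 r))%:Z - (turn q eR (st.2 m))%:Z.

(* Advancing every rotor once around amounts to a firing, so the charge of a
   state is, modulo q, the r-coordinate of a class in Pic that no routing step
   changes. *)
Lemma rr_step_inv u st st' : rotors_inc u st.2 -> rr_step s t rho u st st' ->
  [/\ rotors_inc u st'.2, st'.2 u = st.2 u, deg st'.1 = deg st.1 &
      modeq q (rotor_charge st') (rotor_charge st)].
Proof.
case: st st' => [D rt] [D' rt'] /= hinc [y [/= yu _ hr hD]].
have incy := hinc y yu.
split.
- move=> x xu; rewrite hr; case: eqP => [->|_]; last exact: hinc.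
  by rewrite (inc_rho (fp_ribbon H)).
- by rewrite hr eq_sym (negbTE yu).
- rewrite /deg (eq_bigr _ (fun x _ => hD x)) big_split /= sumrB.
  have one z : \sum_x (x == z)%:R = 1 :> int.
    by rewrite (bigD1 z) //= eqxx big1 ?addr0 // => x /negbTE ->.
  by rewrite !one addrNK.
- rewrite /rotor_charge /= !hr !hD.
  (* A chip leaving l affects no term of the charge. One leaving m reaches r exactly when [turn] of
     the rotor at m goes up, whence the minus sign. One leaving r is traded for a turn of the rotor
     at r. *)
  case/or3P: (fp_V H y) incy => /eqP-> incy; rewrite ?eqxx ?(neq_vertices H).
  + by rewrite (other_l H) ?(inc_rho (fp_ribbon H)) // !(neq_vertices H); exists 0; lia.
  + have [k ->] := turn_rho_m H (rt m).
    rewrite (other_m H) [inc s t r _](inc_r H); exists (- k).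
    by case: (inc s t l _); rewrite ?eqxx ?(neq_vertices H) /=; lia.
  + have [k ->] := turn_rho_r H incy.
    rewrite (other_l H') ?(inc_rho (fp_ribbon H)) // !(neq_vertices H).
    by exists k; lia.
Qed.

Lemma rr_run_inv u st st' : rotors_inc u st.2 -> rr_run s t rho u st st' ->
  [/\ rotors_inc u st'.2, st'.2 u = st.2 u, deg st'.1 = deg st.1 &
      modeq q (rotor_charge st') (rotor_charge st)].
Proof.
move=> + run; elim: run => {st st'} [st|st st1 st2 step _ IH] hinc.
  by split=> //; apply: modeq_refl.
have [/IH [i2 u2 d2 c2] u1 d1 c1] := rr_step_inv hinc step.
by split=> //; [rewrite u2 | rewrite d2 | apply: modeq_trans c2 c1].
Qed.

Definition fire (D : V -> int) (rt : V -> E) y : rstate V E :=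
  (fun x => D x - (x == y)%:R + (x == other s t (rho y (rt y)) y)%:R,
   fun x => if x == y then rho y (rt y) else rt x).

Lemma rr_step_fire u D rt y : y != u -> 0 < D y -> rr_step s t rho u (D, rt) (fire D rt y).
Proof. by move=> yu Dy; exists y. Qed.

(** The disjunction in the hypotheses is preserved by firing: a chip that leaves m for r is still
    off l, and one that goes to l leaves the rotor at m on an l-edge. Once no chips remain off l, it
    says that this rotor points to l. *)
Lemma rr_terminates_l (D : V -> int) rt :
  0 <= D m -> 0 <= D r -> inc s t r (rt r) -> inc s t l (rt m) || (0 < D m + D r) ->
  exists D' rt', [/\ rr_run s t rho l (D, rt) (D', rt'), D' m = 0, D' r = 0 & inc s t l (rt' m)].
Proof.
(* A chip sent from m to l lowers the first term by 2q+1, more than the at most 2q by which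
   [2 * delay] can grow. A chip sent from m to r lowers [2 * delay] by 2 and raises D r by 1. A chip
   sent from r to m lowers D r alone. *)
pose mu (D : V -> int) (rt : V -> E) : nat :=
  (absz (D m + D r)%R * (2 * q + 1) + 2 * delay s t rho l m r q eR (rt m) + absz (D r))%N.
have [n] := ubnP (mu D rt); elim: n D rt => // n IH D rt lt_mu Dm Dr ir ok.
have next y : y != l -> 0 < D y -> (mu (fire D rt y).1 (fire D rt y).2 < mu D rt)%N ->
  0 <= (fire D rt y).1 m -> 0 <= (fire D rt y).1 r -> inc s t r ((fire D rt y).2 r) ->
  inc s t l ((fire D rt y).2 m) || (0 < (fire D rt y).1 m + (fire D rt y).1 r) ->
  exists D' rt', [/\ rr_run s t rho l (D, rt) (D', rt'), D' m = 0, D' r = 0 & inc s t l (rt' m)].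
  move=> yl Dy mu' Dm' Dr' ir' ok'.
  have [|D' [rt' [run m0 r0 il]]] := IH _ _ _ Dm' Dr' ir' ok'; first by lia.
  exists D', rt'; split=> //; apply: rr_next run; exact: rr_step_fire.
have [Dr0|Dr0] : D r = 0 \/ 0 < D r by lia.
  have [Dm0|Dm0] : D m = 0 \/ 0 < D m by lia.
    exists D, rt; split=> //; first exact: rr_refl.
    by move: ok; rewrite Dr0 Dm0 orbF.
  have dq := delay_le s t rho l m r q eR (rho m (rt m)).
  apply: (next m); rewrite ?(neq_vertices H) //= ?eqxx ?(neq_vertices H) ?(other_m H) //.
  - rewrite /mu /= !eqxx !(neq_vertices H).
    case il: (inc s t l _); rewrite ?eqxx !(neq_vertices H).
      have -> : absz (D m + D r) =
        (absz (D m - true%:R + false%:R + (D r - false%:R + false%:R))%R).+1 by lia.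
      have -> : absz (D r - false%:R + false%:R) = absz (D r) by lia.
      by move: (absz _) (absz _) => a b; lia.
    rewrite [delay _ _ _ _ _ _ _ _ (rt m)](delay_rho_m H); last by rewrite (inc_r H) il.
    have -> : absz (D m - true%:R + false%:R + (D r - false%:R + true%:R)) =
      absz (D m + D r) by lia.
    by lia.
  - by case: ifP => il; rewrite ?(neq_vertices H); lia.
  - by case: ifP => il; rewrite ?eqxx ?(neq_vertices H); lia.
  - by case: ifP => il //=; rewrite eqxx !(neq_vertices H); lia.
have om : other s t (rho r (rt r)) r = m.
  by rewrite (other_l H') // (inc_rho (fp_ribbon H)).
apply: (next r); rewrite ?(neq_vertices H) //= ?om ?eqxx ?(neq_vertices H).
- by rewrite /mu /= ?om !eqxx !(neq_vertices H) /=; nia.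
- by lia.
- by lia.
- by rewrite (inc_rho (fp_ribbon H)).
- by case/orP: ok => [->//|ok]; apply/orP; right; lia.
Qed.

(** Every firing moves a chip from l or r directly to the root, so the number of chips at l and r
    decreases. *)
Lemma rr_terminates_m (D : V -> int) rt : 0 <= D l -> 0 <= D r -> inc s t l (rt l) -> inc s t r (rt r) ->
  exists D' rt', [/\ rr_run s t rho m (D, rt) (D', rt'), D' l = 0 & D' r = 0].
Proof.
have [n] := ubnP (absz (D l + D r)); elim: n D rt => // n IH D rt lt_n Dl Dr il ir.
have next y : y != m -> 0 < D y -> other s t (rho y (rt y)) y = m ->
  0 <= D l - (l == y)%:R -> 0 <= D r - (r == y)%:R ->
  0 < (l == y)%:R + (r == y)%:R :> int ->
  exists D' rt', [/\ rr_run s t rho m (D, rt) (D', rt'), D' l = 0 & D' r = 0].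
  move=> ym Dy oy Dl' Dr' lr.
  have [] := IH (fire D rt y).1 (fire D rt y).2; rewrite /= ?oy ?(neq_vertices H).
  - by lia.
  - by lia.
  - by lia.
  - by case: eqP => // <-; rewrite (inc_rho (fp_ribbon H)).
  - by case: eqP => // <-; rewrite (inc_rho (fp_ribbon H)).
  move=> D' [rt' [run l0 r0]]; exists D', rt'; split=> //.
  by have := rr_next (rr_step_fire rt ym Dy); rewrite /fire oy => h; apply: h run.
have [Dl0|Dl0] : D l = 0 \/ 0 < D l by lia.
  have [Dr0|Dr0] : D r = 0 \/ 0 < D r by lia.
    by exists D, rt; split=> //; apply: rr_refl.
  apply: (next r) => //; rewrite ?(neq_vertices H) ?eqxx //; try lia.
  by rewrite (other_l H') // (inc_rho (fp_ribbon H)).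
apply: (next l) => //; rewrite ?(neq_vertices H) ?eqxx //; try lia.
by rewrite (other_l H) // (inc_rho (fp_ribbon H)).
Qed.

Lemma mem_tree_l i j e : e \in [set eL i; eR j] -> inc s t l e -> e = eL i.
Proof.
rewrite !inE => /orP[/eqP //|/eqP ->].
by rewrite (inc_eR H) !(neq_vertices H).
Qed.

(** Rotors at m and r on the same edge bounce between m and r. This excludes the r-edge of the tree
    as rotor at m when the root is l. *)
Lemma oriented_iter_rm (rt : V -> E) n : rt r = rt m -> inc s t r (rt m) ->
  iter n (fun x => if x == l then l else other s t (rt x) x) m != l.
Proof.
move=> rm im; set f := fun x => _.
have om : other s t (rt r) r = m by rewrite (other_l H') // rm.
have or : other s t (rt m) m = r by rewrite (other_m H) -[inc s t l _]negbK -(inc_r H) im.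
have : iter n f m = m \/ iter n f m = r.
  elim: n => [|n [] /= ->]; first by left.
    by right; rewrite /f (neq_vertices H).
  by left; rewrite /f (neq_vertices H).
by case=> ->; rewrite (neq_vertices H).
Qed.

Lemma oriented_m i j rt : oriented s t [set eL i; eR j] m rt <-> rt l = eL i /\ rt r = eR j.
Proof.
split=> [or|[rl rr] y ym].
  split; first by have [|+ + _] := or l; rewrite ?(neq_vertices H) //; apply: mem_tree_l.
  have [|+ + _] := or r; rewrite ?(neq_vertices H) // setUC !inE.
  by rewrite (inc_r H) => /orP[/eqP //|/eqP ->]; rewrite (inc_eL H) eqxx.
have : y = l \/ y = r by case/or3P: (fp_V H y) => /eqP yE; auto; rewrite yE eqxx in ym.
case=> ->; rewrite ?rl ?rr !inE eqxx ?orbT ?(inc_eL H) ?(inc_eR H) eqxx; split=> //.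
all: by exists 1%N; rewrite /= ?rl ?rr (neq_vertices H) ?(other_eL H) ?(other_eR H).
Qed.

Lemma oriented_l i j rt : oriented s t [set eL i; eR j] l rt <-> rt m = eL i /\ rt r = eR j.
Proof.
split=> [or|[rm rr] y yl].
  have rr : rt r = eR j.
    have [|+ + _] := or r; rewrite ?(neq_vertices H) // !inE.
    by move=> /orP[/eqP ->|/eqP //]; rewrite (inc_eL H) !(neq_vertices H).
  split=> //; have [|+ _ [n ln]] := or m; rewrite ?(neq_vertices H) // !inE.
  case/orP => /eqP // rm; have := @oriented_iter_rm rt n.
  by rewrite ln eqxx rr rm (inc_eR H) eqxx => /(_ erefl isT).
have : y = m \/ y = r by case/or3P: (fp_V H y) => /eqP yE; auto; rewrite yE eqxx in yl.
case=> ->; rewrite ?rm ?rr !inE eqxx ?orbT ?(inc_eL H) ?(inc_eR H) eqxx ?orbT; split=> //.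
  by exists 1%N; rewrite /= rm (neq_vertices H) (other_eL H).
exists 2%N; rewrite /= rr (neq_vertices H) (other_eR H) (neq_vertices H) rm.
by rewrite (other_eL H).
Qed.

End Rotor.

Section RotorRel.
Variables (V E : finType) (s t : E -> V) (rho : V -> {perm E}).
Variables (l m r : V) (p q : nat) (eL eR : nat -> E).
Hypothesis H : fat_path s t rho l m r p q eL eR.

Let H' := fat_path_swap H.

Lemma deg_eq0 (D : V -> int) : D m = 0 -> D r = 0 -> deg D = 0 -> D l = 0.
Proof. by rewrite /deg (sum_V H) => -> ->; rewrite !addr0. Qed.

(** The rotor at l is frozen and the one at m starts and ends on an l-edge. The charge at r
    therefore reads off j, and the charge at l reads off i through the rotor at m, which enters with
    a minus sign: hence - D l. *)
Lemma rr_run_l D rt D' rt' i j i' j' : deg D = 0 ->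
  rt m = eL i -> rt r = eR j -> rt' m = eL i' -> rt' r = eR j' ->
  rr_run s t rho l (D, rt) (D', rt') -> D' m = 0 -> D' r = 0 ->
  modeq p i' (i%:Z - D l) /\ modeq q j' (j%:Z + D r).
Proof.
move=> D0 rm rr rm' rr' run m0 r0.
have hinc : rotors_inc s t l rt.
  move=> y yl; case/or3P: (fp_V H y) => /eqP yE; last by rewrite yE rr (inc_eR H) eqxx.
  - by rewrite yE eqxx in yl.
  - by rewrite yE (inc_m H).
have /= [_ lE D'0 [k]] := rr_run_inv (st := (D, rt)) H hinc run.
have [_ _ _ [k']] := rr_run_inv (st := (D, rt)) H' hinc run.
have l0 : D' l = 0 by apply: deg_eq0 => //; rewrite D'0.
rewrite /rotor_charge /= lE rm' rr' rm rr r0 l0 !(turn_eL H).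
have [a ->] := turn_eR H j; have [b ->] := turn_eR H j'.
have [c ->] := turn_eR H' i; have [d ->] := turn_eR H' i'.
move=> e e'; split; [exists (c - d - k') | exists (a - b + k)]; lia.
Qed.

Lemma rr_run_m D rt D' rt' i j i' j' : deg D = 0 ->
  rt l = eL i -> rt r = eR j -> rt' l = eL i' -> rt' r = eR j' ->
  rr_run s t rho m (D, rt) (D', rt') -> D' l = 0 -> D' r = 0 ->
  modeq p i' (i%:Z + D l) /\ modeq q j' (j%:Z + D r).
Proof.
move=> D0 rl rr rl' rr' run l0 r0.
have hinc : rotors_inc s t m rt.
  move=> y ym; case/or3P: (fp_V H y) => /eqP yE; last by rewrite yE rr (inc_eR H) eqxx.
  - by rewrite yE rl (inc_eL H) eqxx.
  - by rewrite yE eqxx in ym.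
have /= [_ mE D'0 [k]] := rr_run_inv (st := (D, rt)) H hinc run.
have [_ _ _ [k']] := rr_run_inv (st := (D, rt)) H' hinc run.
rewrite /rotor_charge /= mE rl' rr' rl rr r0 l0.
have [a ->] := turn_eR H j; have [b ->] := turn_eR H j'.
have [c ->] := turn_eR H' i; have [d ->] := turn_eR H' i'.
move=> e e'; split; [exists (c - d + k') | exists (a - b + k)]; lia.
Qed.

Lemma eq_tree (i j i' j' : nat) : modeq p i i' -> modeq q j j' -> [set eL i; eR j] = [set eL i'; eR j'].
Proof. by move=> /(eL_eq_modeq H) -> /(eL_eq_modeq H') ->. Qed.

Lemma rotor_rel_l D i j i' j' : deg D = 0 ->
  rotor_rel s t rho l D [set eL i; eR j] [set eL i'; eR j'] <->
  modeq p i' (i%:Z - D l) /\ modeq q j' (j%:Z + D r).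
Proof.
move=> degD; split.
  case=> D0 [rt [D1 [rt' [[/(lin_equivP H) [d0 [k hl] [k' hr]]]]]]].
  move=> _ /(oriented_l H) [rm rr] [run D1z _ /(oriented_l H) [rm' rr']].
  have [|||/=] := rr_run_l _ rm rr rm' rr' run; rewrite ?D1z ?(neq_vertices H) ?d0 //.
  by rewrite hl hr => -[a ->] [b ->]; split; [exists (a - k) | exists (b + k')]; lia.
case=> hi hj.
(* An equivalent divisor, nonnegative off l: q * |D r| chips are added at r, then p * N chips are
   moved from l to m, with N large enough, as p > 0, to cover everything that m may owe. *)
pose N := `|D l| + `|D r| + q%:Z * `|D r|.
pose D0 y := if y == l then D l - p%:Z * N else
  if y == r then D r + q%:Z * `|D r| else p%:Z * N - D l - D r - q%:Z * `|D r|.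
pose rt y := if y == m then eL i else eR j.
have [D0l D0m D0r] : [/\ D0 l = D l - p%:Z * N,
    D0 m = p%:Z * N - D l - D r - q%:Z * `|D r| & D0 r = D r + q%:Z * `|D r|].
  by rewrite /D0 !eqxx !(neq_vertices H).
have [rtm rtr] : rt m = eL i /\ rt r = eR j by rewrite /rt !eqxx !(neq_vertices H).
have p0 := fp_p H; have q0 := fp_q H.
have D0m0 : 0 <= D0 m by rewrite D0m; nia.
have D0r0 : 0 <= D0 r by rewrite D0r; nia.
have degD0 : deg D0 = deg D.
  by rewrite /deg !(sum_V H) D0l D0m D0r; move: degD; rewrite /deg (sum_V H); lia.
have [||D1 [rt1 [run m0 r0 il]]] := rr_terminates_l H D0m0 D0r0 (rt := rt).
- by rewrite rtr (inc_eR H) eqxx.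
- by rewrite rtm (inc_eL H) eqxx.
have hinc : rotors_inc s t l rt.
  move=> y yl; case/or3P: (fp_V H y) => /eqP yE; last by rewrite yE rtr (inc_eR H) eqxx.
  - by rewrite yE eqxx in yl.
  - by rewrite yE (inc_m H).
have [hinc' _ _ _] := rr_run_inv (st := (D0, rt)) H hinc run.
have [i1 _ rm1] := inc_lP H il.
have [|j1 _ rr1] := inc_lP H' (e := rt1 r) _.
  by have := hinc' r; rewrite (neq_vertices H) => /(_ isT).
have [|hi1 hj1] := rr_run_l _ rtm rtr rm1 rr1 run m0 r0; first by rewrite degD0.
exists D0, rt, D1, rt1; split; split=> //.
- apply/(lin_equivP H); split=> //; [exists (- N) | exists `|D r|]; lia.
- move=> y yl; case/or3P: (fp_V H y) => /eqP yE; rewrite yE //.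
  by rewrite yE eqxx in yl.
- by apply/(oriented_l H).
- move=> y yl; case/or3P: (fp_V H y) => /eqP yE; rewrite yE //.
  by rewrite yE eqxx in yl.
- by apply/(tree_coordsP H); exists i', j'.
(* The run ends at indices i1, j1 that satisfy the same congruences as i', j', hence name the same
   edges. *)
- rewrite (@eq_tree i' j' i1 j1); first by apply/(oriented_l H).
    case: hi hi1 => [a ->] [b]; rewrite D0l => ->.
    by exists (a - b - N); lia.
  case: hj hj1 => [a ->] [b]; rewrite D0r => ->.
  by exists (a - b - `|D r|); lia.
Qed.

Lemma rotor_rel_m D i j i' j' : deg D = 0 ->
  rotor_rel s t rho m D [set eL i; eR j] [set eL i'; eR j'] <->
  modeq p i' (i%:Z + D l) /\ modeq q j' (j%:Z + D r).
Proof.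
move=> degD; split.
  case=> D0 [rt [D1 [rt' [[/(lin_equivP H) [d0 [k hl] [k' hr]]]]]]].
  move=> _ /(oriented_m H) [rm rr] [run D1z _ /(oriented_m H) [rm' rr']].
  have [|||/=] := rr_run_m _ rm rr rm' rr' run; rewrite ?D1z ?(neq_vertices H) ?d0 //.
  by rewrite hl hr => -[a ->] [b ->]; split; [exists (a + k) | exists (b + k')]; lia.
case=> hi hj.
(* Multiples of p and q large enough to make l and r nonnegative are added there, and the root m
   pays for them. *)
pose D0 y := if y == l then D l + p%:Z * `|D l| else
  if y == r then D r + q%:Z * `|D r| else D m - p%:Z * `|D l| - q%:Z * `|D r|.
pose rt y := if y == l then eL i else eR j.
have [D0l D0m D0r] : [/\ D0 l = D l + p%:Z * `|D l|,
    D0 m = D m - p%:Z * `|D l| - q%:Z * `|D r| & D0 r = D r + q%:Z * `|D r|].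
  by rewrite /D0 !eqxx !(neq_vertices H).
have [rtl rtr] : rt l = eL i /\ rt r = eR j by rewrite /rt !eqxx !(neq_vertices H).
have p0 := fp_p H; have q0 := fp_q H.
have D0l0 : 0 <= D0 l by rewrite D0l; nia.
have D0r0 : 0 <= D0 r by rewrite D0r; nia.
have degD0 : deg D0 = deg D by rewrite /deg !(sum_V H) D0l D0m D0r; lia.
have [||D1 [rt1 [run l0 r0]]] := rr_terminates_m H D0l0 D0r0 (rt := rt).
- by rewrite rtl (inc_eL H) eqxx.
- by rewrite rtr (inc_eR H) eqxx.
have hinc : rotors_inc s t m rt.
  move=> y ym; case/or3P: (fp_V H y) => /eqP yE; last by rewrite yE rtr (inc_eR H) eqxx.
  - by rewrite yE rtl (inc_eL H) eqxx.
  - by rewrite yE eqxx in ym.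
have [hinc' _ _ _] := rr_run_inv (st := (D0, rt)) H hinc run.
have [|i1 _ rl1] := inc_lP H (e := rt1 l) _.
  by have := hinc' l; rewrite (neq_vertices H) => /(_ isT).
have [|j1 _ rr1] := inc_lP H' (e := rt1 r) _.
  by have := hinc' r; rewrite (neq_vertices H) => /(_ isT).
have [|hi1 hj1] := rr_run_m _ rtl rtr rl1 rr1 run l0 r0; first by rewrite degD0.
exists D0, rt, D1, rt1; split; split=> //.
- apply/(lin_equivP H); split=> //; [exists `|D l| | exists `|D r|]; lia.
- move=> y ym; case/or3P: (fp_V H y) => /eqP yE; rewrite yE //.
  by rewrite yE eqxx in ym.
- by apply/(oriented_m H).
- move=> y ym; case/or3P: (fp_V H y) => /eqP yE; rewrite yE //.
  by rewrite yE eqxx in ym.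
- by apply/(tree_coordsP H); exists i', j'.
- rewrite (@eq_tree i' j' i1 j1); first by apply/(oriented_m H).
    case: hi hi1 => [a ->] [b]; rewrite D0l => ->.
    by exists (a - b - `|D l|); lia.
  case: hj hj1 => [a ->] [b]; rewrite D0r => ->.
  by exists (a - b - `|D r|); lia.
Qed.

End RotorRel.

(** * The Bernardi process *)

Section OrbitSplit.
Variables (T : finType) (f : T -> T).
Hypothesis f_inj : injective f.

(** The orbit is listed from the successor of a round to a itself, the order in which the tour goes
    round a vertex entered along a. *)
Lemma orbit_last a :
  exists X, [/\ fpath f a (rcons X a), uniq (rcons X a) & rcons X a =i orbit f a].
Proof.
have [X oX] : exists X, orbit f a = a :: X.
  by rewrite /orbit -orderSpred /=; eexists.
have := cycle_orbit f_inj a; have := orbit_uniq f a; rewrite oX /= => u c.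
exists X; split=> //; first by rewrite rcons_uniq.
by move=> x; rewrite mem_rcons.
Qed.

(** The points a and b cut the cycle into two arcs, each listed with its end point. *)
Lemma orbit_split a b : a != b -> b \in orbit f a ->
  exists X Y, [/\ fpath f a (rcons X b), fpath f b (rcons Y a),
    uniq (rcons X b ++ rcons Y a) & rcons X b ++ rcons Y a =i orbit f a].
Proof.
have [Z [pZ uZ mZ]] := orbit_last a; rewrite -mZ mem_rcons inE eq_sym => /negbTE -> /= bZ.
case/path.splitP: bZ pZ uZ mZ => X Y; rewrite rcons_cat cat_path last_rcons => /andP[pX pY] uZ mZ.
by exists X, Y.
Qed.

End OrbitSplit.

(** The members of S lying in M and the members of M satisfying P are the same elements. In use, S
    lists the edges at an outer vertex and M those already met at m. *)
Lemma count_notin (T : eqType) (P : pred T) (S M : seq T) :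
  uniq S -> uniq M -> S =i P ->
  (count (fun x => x \notin M) S + count P M)%N = size S.
Proof.
move=> uS uM SP; rewrite -[RHS](count_predC (mem M)) addnC; congr (_ + _)%N.
rewrite -!size_filter; apply/perm_size/uniq_perm; rewrite ?filter_uniq // => x.
by rewrite !mem_filter /= SP andbC.
Qed.

Section Chips.
Variables (V E : finType) (s t : E -> V).

Notation inc := (inc s t).
Notation other := (other s t).

(** The sum in [bern_div] for an arbitrary list of half-edges, so that the tour can be evaluated
    block by block. *)
Definition chips (h0 : E * V) (T : {set E}) (W : seq (E * V)) (y : V) : nat :=
  \sum_(i < size W)
     [&& (nth h0 W i).2 == y, (nth h0 W i).1 \notin T &
         ((nth h0 W i).1, other (nth h0 W i).1 (nth h0 W i).2) \notin take i W].

Definition at_vertex (y : V) (S : seq E) : seq (E * V) := [seq (e, y) | e <- S].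

Lemma mem_at_vertex y S e z : ((e, z) \in at_vertex y S) = (z == y) && (e \in S).
Proof.
apply/mapP/andP => [[x xS [-> ->]]|[/eqP -> eS]]; first by rewrite eqxx.
by exists e.
Qed.

Lemma chips_rcons h0 T W h y : chips h0 T (rcons W h) y =
  (chips h0 T W y + [&& h.2 == y, h.1 \notin T & (h.1, other h.1 h.2) \notin W])%N.
Proof.
rewrite /chips size_rcons big_ord_recr /= nth_rcons ltnn eqxx; congr (_ + _)%N.
  apply: eq_bigr => i _; rewrite nth_rcons ltn_ord.
  by rewrite -cats1 take_cat ltn_ord.
by rewrite -cats1 take_size_cat.
Qed.

(** Without loops, the opposite of a half-edge of the block lies at another vertex, so only the part
    W before the block matters. *)
Lemma chips_at_vertex h0 T W y z S : (forall e, e \in S -> other e y != y) ->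
  chips h0 T (W ++ at_vertex y S) z =
  (chips h0 T W z +
   (if y == z then count (fun e => (e \notin T) && ((e, other e y) \notin W)) S else 0))%N.
Proof.
elim/last_ind: S => [|S e IH] noloop; first by rewrite cats0 /= if_same addn0.
rewrite /at_vertex map_rcons -rcons_cat chips_rcons IH /=; last first.
  by move=> x xS; apply: noloop; rewrite mem_rcons inE xS orbT.
rewrite mem_cat mem_at_vertex (negbTE (noloop e _)) ?mem_rcons ?mem_head //= orbF.
by rewrite -addnA; case: eqP => _ //; rewrite -cats1 count_cat /= addn0.
Qed.

(** Each non-tree edge that is met pays exactly one chip, at the first of its half-edges in W. *)
Lemma sum_chips h0 T W : uniq W -> (forall h, h \in W -> inc h.2 h.1) ->
  (\sum_y chips h0 T W y)%N = #|[set e | (e \notin T) && (e \in map fst W)]|.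
Proof.
elim/last_ind: W => [|W [e y] IH].
  move=> _ _; rewrite big1 => [|y _]; last by rewrite /chips big_ord0.
  by apply/esym/eqP; rewrite cards_eq0; apply/eqP/setP => e; rewrite !inE andbF.
rewrite rcons_uniq => /andP[nW uW] iW.
have ie : inc y e by apply: (iW (e, y)); rewrite mem_rcons mem_head.
have {}iW h : h \in W -> inc h.2 h.1.
  by move=> hW; apply: iW; rewrite mem_rcons inE hW orbT.
have eW : (e \in map fst W) = ((e, other e y) \in W).
  apply/mapP/idP => [[[e' y'] h /= ee]|]; last by exists (e, other e y).
  have /= := iW _ h; rewrite -ee in h *.
  have yy : y' != y by apply: contraNneq nW => <-.
  move: ie yy h; rewrite /Defs.inc /Defs.other; case: (s e =P y) => [-> _|_ /= /eqP <-].
    by rewrite eq_sym => /negbTE -> /= h /eqP ->.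
  by rewrite eq_sym => /negbTE -> h; rewrite orbF => /eqP ->.
under eq_bigr do rewrite chips_rcons.
rewrite big_split /= IH // (bigD1 y) //= eqxx big1 => [|z]; last first.
  by rewrite eq_sym => /negbTE ->.
rewrite addn0 map_rcons /= -eW.
have [c|c] := boolP ((e \notin T) && (e \notin map fst W)).
  rewrite addn1 -add1n -[LHS]/((true : nat) + _)%N.
  have -> : [set x | (x \notin T) && (x \in rcons [seq i.1 | i <- W] e)] =
    e |: [set x | (x \notin T) && (x \in [seq i.1 | i <- W])].
    apply/setP => x; rewrite !inE mem_rcons inE; case: eqP => [->|] //=.
    by rewrite andbT; case/andP: c.
  by rewrite cardsU1 inE; case/andP: c => -> /negbTE ->.
rewrite addn0; apply: eq_card => x; rewrite !inE mem_rcons inE; case: eqP => [->|] //=.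
by move: c; case: (e \in T) (e \in _) => [] [].
Qed.

Variable rho : V -> {perm E}.

(** A duplicate-free cycle of [bnext] is the full orbit of its head, so it is the very walk that
    [bern_div] sums over. *)
Lemma bern_div_cycle (T : {set E}) e0 u W y :
  fcycle (bnext s t rho T) ((e0, u) :: W) -> uniq ((e0, u) :: W) ->
  bern_div s t rho T e0 u y = (chips (e0, u) T ((e0, u) :: W) y)%:Z.
Proof.
move=> cW uW; have := orbitE cW uW (mem_head _ _); rewrite /= eqxx rot0 => oW.
have sz : order (bnext s t rho T) (e0, u) = size ((e0, u) :: W).
  by rewrite -oW size_orbit.
rewrite /bern_div -[traject _ _ _]/(orbit _ _) oW; congr (_%:Z).
by rewrite /chips; move: (fingraph.order _ _) sz => N ->.
Qed.

Lemma path_off_tree (T : {set E}) y a X b : inc y a -> is_ribbon s t rho ->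
  fpath (rho y) a (rcons X b) -> {in a :: X, forall e, e \notin T} ->
  fpath (bnext s t rho T) (a, y) (at_vertex y (rcons X b)).
Proof.
move=> + ribbon; elim: X a => [|x X IH] a ia /= /andP[/eqP ax pX] nT.
  by rewrite /= ia (negbTE (nT a (mem_head _ _))) /= ax eqxx.
rewrite /= ia (negbTE (nT a (mem_head _ _))) /= ax eqxx /=; apply: IH => //.
  by rewrite -ax inc_rho.
by move=> e eX; apply: nT; rewrite inE eX orbT.
Qed.

Lemma path_across_tree (T : {set E}) y z a X b : inc z a -> other a z = y -> a \in T ->
  is_ribbon s t rho -> fpath (rho y) a (rcons X b) -> {in X, forall e, e \notin T} ->
  fpath (bnext s t rho T) (a, z) (at_vertex y (rcons X b)).
Proof.
move=> ia ay aT ribbon.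
have iy : inc y a by rewrite -ay inc_other.
case: X => [|x X] /= /andP[/eqP ax pX] nT; rewrite ia aT ay /= ax eqxx //=.
by apply: path_off_tree => //; rewrite -ax inc_rho.
Qed.

End Chips.

Section TurnPath.
Variables (V E : finType) (s t : E -> V) (rho : V -> {perm E}).
Variables (l m r : V) (p q : nat) (eL eR : nat -> E).
Hypothesis H : fat_path s t rho l m r p q eL eR.

Let H' := fat_path_swap H.

Lemma turn_path_m a (S : seq E) : fpath (rho m) a S ->
  modeq q (turn q eR (last a S)) (turn q eR a + count (inc s t r) S)%N.
Proof.
elim: S a => [|x S IH] a /=; first by rewrite addn0 => _; apply: modeq_refl.
case/andP => /eqP <- /IH h; apply: modeq_trans h _.
by have [k e] := turn_rho_m H a; exists k; lia.
Qed.

Lemma turn_path_r a (S : seq E) : inc s t r a -> fpath (rho r) a S ->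
  modeq q (turn q eR (last a S)) (turn q eR a + size S)%N.
Proof.
elim: S a => [|x S IH] a ia /=; first by rewrite addn0 => _; apply: modeq_refl.
case/andP => /eqP <- /IH h; apply: modeq_trans (h _) _.
  by rewrite (inc_rho (fp_ribbon H)).
by have [k e] := turn_rho_r H ia; exists k; lia.
Qed.

Lemma other_neq y e : inc s t y e -> other s t e y != y.
Proof.
case: (fp_E H e) => -[i _ ->]; rewrite ?(inc_eL H) ?(inc_eR H) => /orP[] /eqP ->.
all: by rewrite ?(other_eL H) ?(other_eR H) ?(neq_vertices H).
Qed.

Lemma ring_r j : exists C, [/\ fpath (rho r) (eR j) (rcons C (eR j)),
  uniq (rcons C (eR j)), rcons C (eR j) =i inc s t r & size (rcons C (eR j)) = q].
Proof.
have [C [pC uC mC]] := orbit_last (@perm_inj _ (rho r)) (eR j).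
have mC' : rcons C (eR j) =i inc s t r.
  by move=> e; rewrite mC (inc_orbit (fp_ribbon H)) // (inc_eR H) eqxx.
exists C; split=> //.
by rewrite -(card_uniqP uC) -(card_inc_l H'); apply: eq_card => e; rewrite mC' inE.
Qed.

(** P marks the edges that earn a chip at r. Those missing from P are exactly the ones met earlier
    at m, since the tree edge [eR j] belongs to M as well. *)
Lemma count_off_tree_r (P : pred E) i j C M : uniq C -> C =i inc s t r -> uniq M -> eR j \in M ->
  {in C, forall e, P e = (e \notin [set eL i; eR j]) && (e \notin M)} ->
  (count P C + count (inc s t r) M)%N = size C.
Proof.
move=> uC mC uM jM hP; rewrite -(count_notin uC uM mC); congr (_ + _)%N.
apply: eq_in_count => e eC; rewrite hP // !inE.
have -> : e == eL i = false.
  apply/eqP => h; have := mC e; rewrite eC h => /esym.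
  by rewrite -topredE /= (inc_eL H) !(neq_vertices H).
by case: eqP => //= ->; rewrite jM.
Qed.

End TurnPath.

Section Tour.
Variables (V E : finType) (s t : E -> V) (rho : V -> {perm E}).
Variables (l m r : V) (p q : nat) (eL eR : nat -> E).
Hypothesis H : fat_path s t rho l m r p q eL eR.

Let H' := fat_path_swap H.

Variables (i j : nat) (X Y : seq E).
Hypothesis pX : fpath (rho m) (eL i) (rcons X (eR j)).
Hypothesis pY : fpath (rho m) (eR j) (rcons Y (eL i)).
Hypothesis uXY : uniq (rcons X (eR j) ++ rcons Y (eL i)).
Hypothesis mXY : forall e, e \in rcons X (eR j) ++ rcons Y (eL i).

Let T := [set eL i; eR j].

(** X and Y are the arcs at m between the two tree edges. The walk follows the contour of the tree:
    across [eL i] and around l, back to m and along X, across [eR j] and around r, back to m and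
    along Y. *)
Lemma tour : exists A C,
  [/\ [/\ fpath (rho l) (eL i) (rcons A (eL i)), uniq (rcons A (eL i)),
          rcons A (eL i) =i inc s t l & size (rcons A (eL i)) = p],
      [/\ fpath (rho r) (eR j) (rcons C (eR j)), uniq (rcons C (eR j)),
          rcons C (eR j) =i inc s t r & size (rcons C (eR j)) = q] &
      let W := at_vertex l (rcons A (eL i)) ++ at_vertex m (rcons X (eR j)) ++
               at_vertex r (rcons C (eR j)) ++ at_vertex m (rcons Y (eL i)) in
      [/\ fcycle (bnext s t rho T) W, uniq W & forall h, h \in W -> inc s t h.2 h.1]].
Proof.
have [A [pA uA mA sA]] := ring_r H' i; have [C [pC uC mC sC]] := ring_r H j.
exists A, C; split=> // W.
have aT : eL i \in T by rewrite !inE eqxx.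
have bT : eR j \in T by rewrite !inE eqxx orbT.
have [il jr] : inc s t l (eL i) /\ inc s t r (eR j).
  by rewrite (inc_eL H) (inc_eR H) !eqxx.
have [jnl inr] : ~~ inc s t l (eR j) /\ ~~ inc s t r (eL i).
  by rewrite (inc_eL H) (inc_eR H) !(neq_vertices H).
have nA : {in A, forall e, e \notin T}.
  move=> e eA; rewrite !inE negb_or; apply/andP; split.
    by apply: contraTneq uA => <-; rewrite rcons_uniq eA.
  by apply: contraNneq jnl => <-; have := mA e; rewrite mem_rcons inE eA orbT => /esym.
have nC : {in C, forall e, e \notin T}.
  move=> e eC; rewrite !inE negb_or andbC; apply/andP; split.
    by apply: contraTneq uC => <-; rewrite rcons_uniq eC.
  by apply: contraNneq inr => <-; have := mC e; rewrite mem_rcons inE eC orbT => /esym.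
have [nX nY] : {in X, forall e, e \notin T} /\ {in Y, forall e, e \notin T}.
  move: uXY; rewrite cat_uniq !rcons_uniq => /and3P[/andP[jX _] + /andP[iY _]].
  rewrite has_sym => /hasPn h; split => e eS; rewrite !inE negb_or.
    apply/andP; split; last by apply: contraNneq jX => <-.
    apply: contraTneq (h e _) => [->|]; last by rewrite mem_rcons inE eS orbT.
    by rewrite negbK /= mem_rcons mem_head.
  apply/andP; split; first by apply: contraNneq iY => <-.
  apply: contraTneq (h (eR j) _) => [<-|]; last by rewrite mem_rcons mem_head.
  by rewrite negbK /= mem_rcons inE eS orbT.
have rib := fp_ribbon H.
split.
- have lW x : last x W = (eL i, m) by rewrite /W !last_cat /at_vertex !map_rcons !last_rcons.
  have last_at x (y : V) (S : seq E) b : last x (at_vertex y (rcons S b)) = (b, y).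
    by rewrite /at_vertex map_rcons last_rcons.
  rewrite (cycle_path (eL i, m)) lW /W !cat_path !last_at.
  apply/and4P; split.
  + by apply: path_across_tree; rewrite // ?(inc_m H) ?(other_eL H).
  + by apply: path_across_tree; rewrite // ?(other_eL H).
  + by apply: path_across_tree; rewrite // ?(inc_m H) ?(other_eR H).
  + by apply: path_across_tree; rewrite // ?(other_eR H).
- have ua (y : V) (S : seq E) : uniq S -> uniq (at_vertex y S) by move=> uS; rewrite map_inj_uniq // => ? ? [].
  have dis (y z : V) : (y == z) = false -> forall S S' : seq E, has (mem (at_vertex y S)) (at_vertex z S') = false.
    move=> yz S S'; apply/hasPn => -[e x]; rewrite mem_at_vertex => /andP[/eqP -> _] /=.
    by rewrite mem_at_vertex eq_sym yz.
  have [[lm mr] [rm lr]] : ((l == m = false) * (m == r = false)) * ((r == m = false) * (l == r = false)).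
    by rewrite !(neq_vertices H).
  move: uXY; rewrite cat_uniq => /and3P[uX nXY uY].
  rewrite /W !cat_uniq !has_cat !negb_or !ua // !(dis _ _ lm) !(dis _ _ mr) (dis _ _ rm) (dis _ _ lr) /= andbT.
  apply/hasPn => -[e x]; rewrite mem_at_vertex => /andP[/eqP -> eY] /=.
  by rewrite mem_at_vertex eqxx /=; apply: (hasPn nXY).
- move=> [e y]; rewrite /W !mem_cat !mem_at_vertex.
  case/or4P => /andP[/eqP -> /= h]; rewrite ?(inc_m H) //.
    by have := mA e; rewrite h => /esym.
  by have := mC e; rewrite h => /esym.
Qed.

(** Every edge is met at m, so each of the p + q - 2 non-tree edges pays its chip. *)
Lemma deg_chips h0 W : uniq W -> (forall h, h \in W -> inc s t h.2 h.1) ->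
  (forall e, (e, m) \in W) -> (\sum_y chips s t h0 T W y)%N = (p + q - 2)%N.
Proof.
move=> uW iW mW; rewrite (sum_chips _ _ uW iW).
have := cardsC T; rewrite (card_E H) cards2.
have -> : eL i != eR j.
  by apply/eqP => h; have := inc_eL H i l; rewrite h (inc_eR H) !(neq_vertices H) eqxx.
move=> <-; rewrite addKn; apply: eq_card => e; rewrite !inE.
by rewrite (map_f fst (mW e)) andbT.
Qed.

(** At l, chips come from the edges passed from e0 up to [eL i], before m is reached. At r, they
    come from the edges not met on the arc of m from [eL i] to [eR j], which contains j + 1 r-edges
    modulo q. *)
Lemma bern_div_l e0 : inc s t l e0 ->
  [/\ deg (bern_div s t rho T e0 l) = (p + q - 2)%N,
      modeq p (bern_div s t rho T e0 l l) (i%:Z + 1 - (turn p eL e0)%:Z) &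
      modeq q (bern_div s t rho T e0 l r) (- j%:Z - 1)].
Proof.
move=> ie0; have [A [C [[pA uA mA sA] [pC uC mC sC] []]]] := tour.
have [A1 [A2 eA]] : exists A1 A2 : seq E, rcons A (eL i) = A1 ++ e0 :: A2.
  have : e0 \in rcons A (eL i) by rewrite mA.
  by case/splitPr => A1 A2; exists A1, A2.
rewrite eA; set B := rcons X _; set D := rcons Y _.
rewrite /at_vertex map_cat -!/(at_vertex _ _) -catA.
set W0 := at_vertex l A1 ++ _; set W := at_vertex l (e0 :: A2) ++
  at_vertex m B ++ at_vertex r (rcons C (eR j)) ++ at_vertex m D ++ at_vertex l A1.
have WE : W = rot (size (at_vertex l A1)) W0 by rewrite rot_size_cat /W -!catA.
rewrite -(rot_cycle (size (at_vertex l A1))) -(rot_uniq (size (at_vertex l A1))) -WE.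
move=> cW uW iW0.
have iW h : h \in W -> inc s t h.2 h.1 by rewrite WE mem_rot; apply: iW0.
have nl : {in A1 ++ e0 :: A2, forall e, other s t e l != l}.
  by move=> e; rewrite -eA mA => ?; apply: (other_neq H).
have nr : {in rcons C (eR j), forall e, other s t e r != r}.
  by move=> e; rewrite mC => ?; apply: (other_neq H).
have nm S : {in S, forall e, other s t e m != m}.
  by move=> e _; rewrite (other_neq H) // (inc_m H).
have bE y : bern_div s t rho T e0 l y = (chips s t (e0, l) T W y)%:Z by apply: bern_div_cycle.
have mW e : (e, m) \in W.
  rewrite /W !mem_cat !mem_at_vertex eqxx !(neq_vertices H) /= orbF -mem_cat.
  exact: mXY.
have cE y : chips s t (e0, l) T W y = chips s t (e0, l) T
   (((((nil ++ at_vertex l (e0 :: A2)) ++ at_vertex m B) ++ at_vertex r (rcons C (eR j)))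
    ++ at_vertex m D) ++ at_vertex l A1) y by rewrite -!catA.
have c0 y : chips s t (e0, l) T [::] y = 0%N by rewrite /chips big_ord0.
have nA1 : {in A1, forall e, other s t e l != l}.
  by move=> e eS; apply: nl; rewrite mem_cat eS.
have nA2 : {in e0 :: A2, forall e, other s t e l != l}.
  by move=> e eS; apply: nl; rewrite mem_cat eS orbT.
split.
- rewrite /deg (eq_bigr _ (fun y _ => bE y)).
  by rewrite -(deg_chips (e0, l) uW iW mW) (big_morph Posz PoszD erefl).
- rewrite bE cE !chips_at_vertex //; try exact: nm.
  rewrite c0 eqxx !(neq_vertices H) !addn0 add0n.
  set c1 := count _ _; set c2 := count _ _.
  (* On the return to l both arcs at m have been visited, so every opposite half-edge is already
     met. *)
  have -> : c2 = 0%N.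
    apply/eqP; rewrite -leqn0 leqNgt -has_count; apply/hasPn => e eA1.
    have ie : inc s t l e by have := mA e; rewrite eA mem_cat eA1 => /esym.
    rewrite (other_l H ie) negb_and orbC !negbK.
    rewrite !mem_cat !mem_at_vertex eqxx !(neq_vertices H) /= orbF -mem_cat.
    by rewrite mXY.
  (* The first block at l ends with the tree edge [eL i], the only one in it that earns nothing. *)
  have [Z eZ] : exists Z : seq E, e0 :: A2 = rcons Z (eL i).
    case/lastP: A2 eA {W WE cW uW iW bE mW cE nl nA2 W0 iW0 c1 c2} => [|A2 x].
      by rewrite cats1 => /rcons_inj [_ <-]; exists [::].
    by rewrite -rcons_cons -rcons_cat => /rcons_inj [_ <-]; exists (e0 :: A2).
  have szZ : size Z = size A2.
    by have := congr1 size eZ; rewrite size_rcons /= => -[].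
  have -> : c1 = size A2.
    rewrite /c1 eZ -cats1 count_cat /= !inE eqxx /= !addn0 -szZ.
    apply/eqP; rewrite -all_count; apply/allP => e eS /=.
    move: uA; rewrite eA eZ -rcons_cat rcons_uniq mem_cat => /andP[ni _].
    have ie : inc s t l e by have := mA e; rewrite eA eZ mem_cat mem_rcons inE eS !orbT => /esym.
    rewrite !inE negb_or andbT; apply/andP; split.
      by apply: contraNneq ni => <-; rewrite eS orbT.
    by apply: contraTneq ie => ->; rewrite (inc_eR H) !(neq_vertices H).
  move: pA; rewrite eA cat_path /= => /and3P[_ _ pA2].
  have := turn_path_r H' ie0 pA2.
  have -> : last e0 A2 = eL i by rewrite -[LHS]/(last e0 (e0 :: A2)) eZ last_rcons.
  have [k ->] := turn_eR H' i; case=> k' h; exists (k - k').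
  by clear -h; lia.
- rewrite bE cE !chips_at_vertex //; try exact: nm.
  rewrite c0 eqxx !(neq_vertices H) !addn0 !add0n.
  have [uB _] : uniq B /\ uniq D by move: uXY; rewrite cat_uniq => /and3P[].
  have jB : eR j \in B by rewrite mem_rcons mem_head.
  set c := count _ _.
  have : (c + count (inc s t r) B)%N = q.
    rewrite -sC; apply: (count_off_tree_r H (i := i)) uB jB _ => // e eC.
    have ie : inc s t r e by have := mC e; rewrite eC => /esym.
    by rewrite (other_l H' ie) cat0s mem_cat !mem_at_vertex eqxx !(neq_vertices H).
  have := turn_path_m H pX; rewrite last_rcons (turn_eL H) -/B.
  have [k ->] := turn_eR H j; case=> k' h h'; exists (k' - k + 1).
  by clearbody c B; clear -h h'; lia.
Qed.

(* The case e0 \in rcons Y (eL i) is this one after exchanging l and r. *)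
Lemma bern_div_m_before e0 : e0 \in rcons X (eR j) ->
  [/\ deg (bern_div s t rho T e0 m) = (p + q - 2)%N,
      modeq p (bern_div s t rho T e0 m l)
        ((turn p eL e0)%:Z - (inc s t l e0 : nat)%:Z - i%:Z - 1) &
      modeq q (bern_div s t rho T e0 m r)
        ((turn q eR e0)%:Z - (inc s t r e0 : nat)%:Z - j%:Z - 1)].
Proof.
move=> e0X; have [A [C [[pA uA mA sA] [pC uC mC sC] []]]] := tour.
have [B1 [B2 eB]] : exists B1 B2 : seq E, rcons X (eR j) = B1 ++ e0 :: B2.
  by case/splitPr: e0X => B1 B2; exists B1, B2.
rewrite eB; set D := rcons Y _.
rewrite /at_vertex map_cat -!/(at_vertex _ _) -catA.
set W0 := at_vertex l _ ++ _; set W := at_vertex m (e0 :: B2) ++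
  at_vertex r (rcons C (eR j)) ++ at_vertex m D ++ at_vertex l (rcons A (eL i)) ++ at_vertex m B1.
have WE : W = rot (size (at_vertex l (rcons A (eL i)) ++ at_vertex m B1)) W0.
  by rewrite /W0 catA rot_size_cat /W -!catA.
rewrite -(rot_cycle (size (at_vertex l (rcons A (eL i)) ++ at_vertex m B1))).
rewrite -(rot_uniq (size (at_vertex l (rcons A (eL i)) ++ at_vertex m B1))) -WE.
move=> cW uW iW0.
have iW h : h \in W -> inc s t h.2 h.1 by rewrite WE mem_rot; apply: iW0.
have nl : {in rcons A (eL i), forall e, other s t e l != l}.
  by move=> e; rewrite mA => ?; apply: (other_neq H).
have nr : {in rcons C (eR j), forall e, other s t e r != r}.
  by move=> e; rewrite mC => ?; apply: (other_neq H).
have nm S : {in S, forall e, other s t e m != m}.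
  by move=> e _; rewrite (other_neq H) // (inc_m H).
have bE y : bern_div s t rho T e0 m y = (chips s t (e0, m) T W y)%:Z by apply: bern_div_cycle.
have mW e : (e, m) \in W.
  rewrite /W !mem_cat !mem_at_vertex eqxx !(neq_vertices H) /=.
  by have := mXY e; rewrite eB !mem_cat; case: (e \in B1); rewrite ?orbT ?orbF.
have cE y : chips s t (e0, m) T W y = chips s t (e0, m) T
   (((((nil ++ at_vertex m (e0 :: B2)) ++ at_vertex r (rcons C (eR j))) ++ at_vertex m D)
    ++ at_vertex l (rcons A (eL i))) ++ at_vertex m B1) y by rewrite -!catA.
have c0 y : chips s t (e0, m) T [::] y = 0%N by rewrite /chips big_ord0.
have lastB2 : last e0 B2 = eR j.
  by rewrite -[LHS]/(last (last e0 B1) (e0 :: B2)) -last_cat -eB last_rcons.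
have pm : fpath (rho m) e0 (B2 ++ D).
  by move: pX; rewrite eB !cat_path /= lastB2 => /and3P[_ _ ->].
have uBD : uniq (e0 :: B2 ++ D).
  by move: uXY; rewrite eB -catA cat_uniq => /and3P[].
have uB2 : uniq (e0 :: B2) by move: uBD; rewrite -cat_cons cat_uniq => /and3P[].
have jB2 : eR j \in e0 :: B2 by rewrite -lastB2 mem_last.
split.
- rewrite /deg (eq_bigr _ (fun y _ => bE y)).
  by rewrite -(deg_chips (e0, m) uW iW mW) (big_morph Posz PoszD erefl).
- rewrite bE cE !chips_at_vertex //; try exact: nm.
  rewrite c0 eqxx !(neq_vertices H) !addn0 !add0n.
  set c := count _ _.
  (* When the tour comes to l it has met at m the edges from e0 through [eR j] to [eL i]; the other
     edges at l earn a chip. For r, treated below, the part met at m ends at [eR j]. *)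
  have : (c + (inc s t l e0 + count (inc s t l) (B2 ++ D)))%N = p.
    rewrite -[(nat_of_bool _ + _)%N]/(count (inc s t l) (e0 :: B2 ++ D)).
    have iBD : eL i \in e0 :: B2 ++ D by rewrite inE mem_cat mem_rcons mem_head !orbT.
    rewrite -sA; apply: (count_off_tree_r H' (i := j)) uBD iBD _ => // e eA.
    have ie : inc s t l e by have := mA e; rewrite eA => /esym.
    rewrite (other_l H ie) cat0s !mem_cat !mem_at_vertex eqxx !(neq_vertices H) /= orbF.
    by rewrite -cat_cons mem_cat setUC -/T.
  have := turn_path_m H' pm; rewrite last_cat last_rcons.
  have [k ->] := turn_eR H' i; case=> k' h h'; exists (k' - k + 1).
  by clearbody c; clear -h h'; lia.
- rewrite bE cE !chips_at_vertex //; try exact: nm.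
  rewrite c0 eqxx !(neq_vertices H) !addn0 !add0n.
  set c := count _ _.
  have : (c + (inc s t r e0 + count (inc s t r) B2))%N = q.
    rewrite -[(nat_of_bool _ + _)%N]/(count (inc s t r) (e0 :: B2)).
    rewrite -sC; apply: (count_off_tree_r H (i := i)) uB2 jB2 _ => // e eC.
    have ie : inc s t r e by have := mC e; rewrite eC => /esym.
    by rewrite (other_l H' ie) cat0s mem_at_vertex eqxx.
  move: pm; rewrite cat_path => /andP[/(turn_path_m H) + _]; rewrite lastB2.
  have [k ->] := turn_eR H j; case=> k' h h'; exists (k' - k + 1).
  by clearbody c; clear -h h'; lia.
Qed.

End Tour.

Section BernRel.
Variables (V E : finType) (s t : E -> V) (rho : V -> {perm E}).
Variables (l m r : V) (p q : nat) (eL eR : nat -> E).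
Hypothesis H : fat_path s t rho l m r p q eL eR.

Let H' := fat_path_swap H.

Lemma m_split i j : exists X Y,
  [/\ fpath (rho m) (eL i) (rcons X (eR j)), fpath (rho m) (eR j) (rcons Y (eL i)),
      uniq (rcons X (eR j) ++ rcons Y (eL i)) &
      forall e, e \in rcons X (eR j) ++ rcons Y (eL i)].
Proof.
have [||X [Y [pX pY uXY mXY]]] := @orbit_split _ (rho m) perm_inj (eL i) (eR j).
- by apply/eqP => h; have := inc_eL H i l; rewrite h (inc_eR H) !(neq_vertices H) eqxx.
- by rewrite (inc_orbit (fp_ribbon H) (inc_m H _)) inE (inc_m H).
exists X, Y; split=> // e.
by rewrite mXY (inc_orbit (fp_ribbon H) (inc_m H _)) inE (inc_m H).
Qed.

Lemma bern_div_m i j e0 :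
  [/\ deg (bern_div s t rho [set eL i; eR j] e0 m) = (p + q - 2)%N,
      modeq p (bern_div s t rho [set eL i; eR j] e0 m l)
        ((turn p eL e0)%:Z - (inc s t l e0 : nat)%:Z - i%:Z - 1) &
      modeq q (bern_div s t rho [set eL i; eR j] e0 m r)
        ((turn q eR e0)%:Z - (inc s t r e0 : nat)%:Z - j%:Z - 1)].
Proof.
have [X [Y [pX pY uXY mXY]]] := m_split i j.
have := mXY e0; rewrite mem_cat => /orP[e0X|e0Y]; first exact: (bern_div_m_before H pX pY uXY mXY e0X).
have uYX : uniq (rcons Y (eL i) ++ rcons X (eR j)) by rewrite uniq_catC.
have mYX e : e \in rcons Y (eL i) ++ rcons X (eR j) by have := mXY e; rewrite !mem_cat orbC.
have := bern_div_m_before H' pY pX uYX mYX e0Y.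
by rewrite [[set eR j; eL i]]setUC [(q + p)%N]addnC => -[].
Qed.

(** The terms of [bern_div_m] in e0 are the same for both trees and cancel, so the condition for one
    e0 is the condition for all. *)
Lemma bern_rel_m D i j i' j' : deg D = 0 ->
  bern_rel s t rho m D [set eL i; eR j] [set eL i'; eR j'] <->
  modeq p i' (i%:Z - D l) /\ modeq q j' (j%:Z - D r).
Proof.
move=> D0.
have key e0 : lin_equiv s t (fun y => bern_div s t rho [set eL i; eR j] e0 m y + D y)
    (bern_div s t rho [set eL i'; eR j'] e0 m) <->
    modeq p i' (i%:Z - D l) /\ modeq q j' (j%:Z - D r).
  have [d1 [a ha] [b hb]] := bern_div_m i j e0.
  have [d2 [a' ha'] [b' hb']] := bern_div_m i' j' e0.
  rewrite (lin_equivP H).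
  have -> : deg (fun y => bern_div s t rho [set eL i; eR j] e0 m y + D y) =
            deg (bern_div s t rho [set eL i; eR j] e0 m) + deg D by rewrite /deg big_split.
  rewrite d1 d2 D0 addr0 /= ha hb ha' hb'; move: (D l) (D r) => x y.
  split=> [[_ [c hc] [d hd]]|[[c hc] [d hd]]].
    by split; [exists (a' - a - c) | exists (b' - b - d)]; clear -hc hd; lia.
  by split=> //; [exists (a' - a - c) | exists (b' - b - d)]; clear -hc hd; lia.
split=> [[_ h]|h]; first by apply/(key (eL 0))/h; rewrite (inc_m H).
by split=> [|e0 _]; [apply/(tree_coordsP H); exists i', j' | apply/key].
Qed.

Lemma bern_rel_l D i j i' j' : deg D = 0 ->
  bern_rel s t rho l D [set eL i; eR j] [set eL i'; eR j'] <->
  modeq p i' (i%:Z + D l) /\ modeq q j' (j%:Z - D r).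
Proof.
move=> D0.
have key e0 : inc s t l e0 ->
    lin_equiv s t (fun y => bern_div s t rho [set eL i; eR j] e0 l y + D y)
      (bern_div s t rho [set eL i'; eR j'] e0 l) <->
    modeq p i' (i%:Z + D l) /\ modeq q j' (j%:Z - D r).
  move=> ie0.
  have [X [Y [pX pY uXY mXY]]] := m_split i j.
  have [X' [Y' [pX' pY' uXY' mXY']]] := m_split i' j'.
  have [d1 [a ha] [b hb]] := bern_div_l H pX pY uXY mXY ie0.
  have [d2 [a' ha'] [b' hb']] := bern_div_l H pX' pY' uXY' mXY' ie0.
  rewrite (lin_equivP H).
  have -> : deg (fun y => bern_div s t rho [set eL i; eR j] e0 l y + D y) =
            deg (bern_div s t rho [set eL i; eR j] e0 l) + deg D by rewrite /deg big_split.
  rewrite d1 d2 D0 addr0 /= ha hb ha' hb'; move: (D l) (D r) => x y.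
  split=> [[_ [c hc] [d hd]]|[[c hc] [d hd]]].
    by split; [exists (a - a' + c) | exists (b' - b - d)]; clear -hc hd; lia.
  by split=> //; [exists (a' - a + c) | exists (b' - b - d)]; clear -hc hd; lia.
have il : inc s t l (eL 0) by rewrite (inc_eL H) eqxx.
split=> [[_ h]|h]; first by apply/(key (eL 0) il)/h.
by split=> [|e0 ie0]; [apply/(tree_coordsP H); exists i', j' | apply/(key _ ie0)].
Qed.

End BernRel.

(** * Genus *)

(** The invariant k separates x from y, and every point is connected to one of them, so their roots
    are the only two. *)
Lemma n_comp_two (T : finType) (e : rel T) (A : {pred T}) (k : T -> bool) x y :
  connect_sym e -> (forall a b, e a b -> k a = k b) -> x \in A -> y \in A ->
  closed e A -> k x -> ~~ k y ->
  {in A, forall a, connect e a (if k a then x else y)} -> n_comp e A = 2.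
Proof.
move=> sym kinv xA yA clA kx ky conn.
have kc a b : connect e a b -> k a = k b.
  have cl : closed e [pred z | k z] by move=> ? ? /kinv.
  by move/(closed_connect cl); rewrite !inE.
have nxy : ~~ connect e x y by apply: contraNN ky => /kc <-.
have -> : n_comp e A = #|[set fingraph.root e x; fingraph.root e y]|.
  apply: eq_card => z; rewrite !inE.
  apply/andP/orP => [[/eqP rz zA]|].
    have := conn z zA; case: (k z) => c; [left | right].
      by rewrite -rz; apply/eqP/(fingraph.rootP sym).
    by rewrite -rz; apply/eqP/(fingraph.rootP sym).
  by case=> /eqP ->; rewrite (roots_root sym) -(closed_connect clA (connect_root e _)).
by rewrite cards2 (root_connect sym) nxy.
Qed.

Section Faces.
Variables (V E : finType) (s t : E -> V) (rho : V -> {perm E}).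
Variables (l m r : V) (p q : nat) (eL eR : nat -> E).
Hypothesis H : fat_path s t rho l m r p q eL eR.

Notation fn := (face_next s t rho).

Lemma face_R i : fn (eR i, r) = (rho m (eR i), m).
Proof. by rewrite /face_next (inc_eR H) eqxx (other_eR H). Qed.

Lemma face_mR i : fn (eR i, m) = (eR i.+1, r).
Proof. by rewrite /face_next (inc_eR H) eqxx orbT (other_eR H) (fp_rhor H). Qed.

Lemma face_L i : fn (eL i, l) = (rho m (eL i), m).
Proof. by rewrite /face_next (inc_eL H) eqxx (other_eL H). Qed.

Lemma face_mL i : fn (eL i, m) = (eL i.+1, l).
Proof. by rewrite /face_next (inc_eL H) eqxx orbT (other_eL H) (fp_rhol H). Qed.

Lemma face_closed : fclosed fn (fun h : E * V => inc s t h.2 h.1).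
Proof.
move=> [e y] h' /eqP <-; rewrite unfold_in /= /face_next.
case: ifP => ie; last by rewrite unfold_in /= ie.
by rewrite unfold_in /= (inc_rho (fp_ribbon H)) inc_other.
Qed.

Lemma dartP h : inc s t h.2 h.1 ->
  (exists2 i, (i < p)%N & h = (eL i, l) \/ h = (eL i, m)) \/
  (exists2 j, (j < q)%N & h = (eR j, r) \/ h = (eR j, m)).
Proof.
case: h => e y /=; case: (fp_E H e) => -[i ip ->]; rewrite ?(inc_eL H) ?(inc_eR H).
  by case/orP => /eqP ->; left; exists i; auto.
by case/orP => /eqP ->; right; exists i; auto.
Qed.

Lemma fconn_step h h' : fconnect fn (fn h) h' -> fconnect fn h h'.
Proof. exact: connect_trans (fconnect1 _ _). Qed.

Lemma fconn_sym h h' : fconnect fn h h' -> fconnect fn h' h.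
Proof. by rewrite (fconnect_sym (face_next_inj (fp_ribbon H))). Qed.

(** Seen from m, a face advances two r-edges at a time until it would leave the r-block; the parity
    of the index then decides the number of faces. *)
Lemma face_mR2 i : (i.+2 < q)%N -> fn (fn (eR i, m)) = (eR i.+2, m).
Proof.
move=> iq; rewrite face_mR face_R (fp_rhomR H) ifF //.
by rewrite gtnNdvd.
Qed.

Lemma face_even k : (k.*2 < q)%N -> fconnect fn (eR 0, m) (eR k.*2, m).
Proof.
elim: k => [|k IH] kq; first exact: connect0.
apply: connect_trans (IH _) _; first by move: kq; rewrite doubleS; lia.
by rewrite doubleS -face_mR2 //; apply/fconn_step/fconnect1.
Qed.

Lemma face_odd k : (k.*2.+1 < q)%N -> fconnect fn (eR 1, m) (eR k.*2.+1, m).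
Proof.
elim: k => [|k IH] kq; first exact: connect0.
apply: connect_trans (IH _) _; first by move: kq; rewrite doubleS; lia.
by rewrite doubleS -face_mR2 //; apply/fconn_step/fconnect1.
Qed.

End Faces.

(** The two l-edges bound a digon. For odd q the even positions end at q - 1, whence the face goes
    through r to position 1: the even and odd positions share a face, which also takes in the
    remaining darts at l-edges. *)
Lemma ncycles_double (V E : finType) (s t : E -> V) rho l m r q eL eR :
  fat_path s t rho l m r 2 q eL eR -> odd q -> (1 < q)%N -> ncycles s t rho = 2.
Proof.
move=> H oq q1; pose fn := face_next s t rho.
have fI : injective fn := face_next_inj (fp_ribbon H).
have eL2 : eL 2 = eL 0 by apply/eqP; rewrite (fp_eqL H).
have f1m : fn (eL 1, m) = (eL 0, l) by rewrite /fn (face_mL H) eL2.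
have f0l : fn (eL 0, l) = (eL 1, m) by rewrite /fn (face_L H) (fp_rhomL H).
have f0m : fn (eL 0, m) = (eL 1, l) by rewrite /fn (face_mL H).
have f1l : fn (eL 1, l) = (eR 0, m) by rewrite /fn (face_L H) (fp_rhomL H).
have cR h : inc s t r h.1 -> h.2 = m -> fconnect fn (eR 0, m) h.
  case: h => e y /= /(inc_lP (fat_path_swap H)) [j jq ->] ->.
  case: (boolP (odd j)) => oj.
    have jE : j = j./2.*2.+1 by rewrite -[LHS]odd_double_half oj.
    rewrite jE in jq *; apply: connect_trans (face_odd H jq).
    have qE : q = q./2.*2.+1 by rewrite -[LHS]odd_double_half oq.
    have lt : (q./2.*2 < q)%N by rewrite {2}qE.
    apply: connect_trans (face_even H lt) _.
    apply: fconn_step; rewrite (face_mR H) -qE.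
    apply: fconn_step; rewrite (face_R H) (fp_rhomR H) ifF ?connect0; last first.
      by rewrite -addn1 dvdn_addr // gtnNdvd.
    have -> // : eR q.+1 = eR 1 by apply/eqP; rewrite (fp_eqR H) -addn1 modnDl.
  have jE : j = j./2.*2 by rewrite -[LHS]odd_double_half (negbTE oj).
  by rewrite jE in jq *; apply: (face_even H jq).
have c0m : fconnect fn (eR 0, m) (eL 0, m).
  apply: (fconn_sym H); apply: fconn_step; rewrite -/fn f0m.
  by apply: fconn_step; rewrite -/fn f1l connect0.
pose other_face h := (h == (eL 1, m)) || (h == (eL 0, l)).
have nRL i j : eR i == eL j = false.
  apply/eqP => h; have := inc_eL H j l; by rewrite -h (inc_eR H) !(neq_vertices H) eqxx.
apply: (@n_comp_two _ _ _ (fun h => ~~ other_face h) (eR 0, m) (eL 1, m)).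
- exact: fconnect_sym fI.
- move=> h h' /eqP <-; rewrite -/fn /other_face.
  have -> : (fn h == (eL 1, m)) = (h == (eL 0, l)) by rewrite -f0l (inj_eq fI).
  have -> : (fn h == (eL 0, l)) = (h == (eL 1, m)) by rewrite -f1m (inj_eq fI).
  by rewrite orbC.
- by rewrite unfold_in /= (inc_m H).
- by rewrite unfold_in /= (inc_m H).
- exact: face_closed H.
- by rewrite /other_face !xpair_eqE !nRL.
- by rewrite /other_face eqxx.
- move=> h hA; case: ifP; rewrite /other_face.
    move=> nh; apply: (fconn_sym H).
    case: (dartP H hA) => -[i ip [] hE]; rewrite hE in nh *.
    + case: i ip {hE} nh => [|[|//]] _; first by rewrite eqxx orbT.
      by move=> _; apply: connect_trans c0m _; apply: fconn_step; rewrite -/fn f0m connect0.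
    + case: i ip {hE} nh => [|[|//]] _; first by move=> _; apply: c0m.
      by rewrite eqxx.
    + apply: (fconn_sym H); apply: fconn_step; rewrite (face_R H) (fp_rhomR H).
      by apply: (fconn_sym H); case: ifP => _ //; apply: cR; rewrite //= (inc_eR H) eqxx.
    + by apply: cR; rewrite //= (inc_eR H) eqxx.
  move/negbFE => /orP[] /eqP ->; first exact: connect0.
  by apply: fconn_step; rewrite -/fn f0l connect0.
Qed.

(** For even q the parity of the position survives the passage round the r-block, and the bridge is
    inserted into the face of the even positions. *)
Lemma ncycles_bridge (V E : finType) (s t : E -> V) rho l m r q eL eR :
  fat_path s t rho l m r 1 q eL eR -> ~~ odd q -> ncycles s t rho = 2.
Proof.
move=> H eq; pose fn := face_next s t rho; have q0 := fp_q H.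
have fI : injective fn := face_next_inj (fp_ribbon H).
have eL1 : eL 1 = eL 0 by apply/eqP; rewrite (fp_eqL H).
have f0m : fn (eL 0, m) = (eL 0, l) by rewrite /fn (face_mL H) eL1.
have f0l : fn (eL 0, l) = (eR 0, m) by rewrite /fn (face_L H) (fp_rhomL H).
(* A face step from m to r raises the index by one, so the parity is flipped at r. As q is even,
   [turn] determines the parity of the index of an r-edge. *)
pose k (h : E * V) := inc s t l h.1 || (odd (turn q eR h.1) (+) (h.2 == r)).
have kL i y : k (eL i, y) by rewrite /k /= (inc_eL H) eqxx.
have kR i y : k (eR i, y) = ~~ odd i (+) (y == r).
  rewrite /k /= (inc_eR H) !(neq_vertices H) /= -(eR_mod H) (turn_small H) ?ltn_mod //=.
  congr (~~ _ (+) _); rewrite [in RHS](divn_eq i q) oddD oddM (negbTE eq) andbF.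
  by [].
have kinv h h' : frel fn h h' -> k h = k h'.
  move=> /eqP <-; case: (boolP (inc s t h.2 h.1)) => ih; last first.
    by case: h ih => e y ih; rewrite /fn /face_next (negbTE ih).
  case: (dartP H ih) => -[i ip [] ->].
  - by case: i ip => // _; rewrite f0l kL kR !(neq_vertices H).
  - by case: i ip => // _; rewrite f0m !kL.
  - rewrite /fn (face_R H) kR (fp_rhomR H) eqxx; case: ifP => [|_].
      rewrite kL => /dvdnP[c] /(congr1 odd); rewrite oddM (negbTE eq) andbF /=.
      by move/negbFE ->.
    by rewrite kR /= !(neq_vertices H); case: (odd i).
  - by rewrite /fn (face_mR H) !kR /= eqxx !(neq_vertices H); case: (odd i).
have cR h : inc s t r h.1 -> h.2 = m ->
    fconnect fn h (if k h then (eR 0, m) else (eR 1, m)).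
  case: h => e y /= /(inc_lP (fat_path_swap H)) [j jq ->] ->; rewrite kR !(neq_vertices H) addbF.
  apply: (fconn_sym H); case: (boolP (odd j)) => oj /=.
    have jE : j = j./2.*2.+1 by rewrite -[LHS]odd_double_half oj.
    by rewrite jE in jq *; apply: (face_odd H jq).
  have jE : j = j./2.*2 by rewrite -[LHS]odd_double_half (negbTE oj).
  by rewrite jE in jq *; apply: (face_even H jq).
apply: (@n_comp_two _ _ _ k (eR 0, m) (eR 1, m)) => //.
- exact: fconnect_sym fI.
- by rewrite unfold_in /= (inc_m H).
- by rewrite unfold_in /= (inc_m H).
- exact: face_closed H.
- by rewrite kR !(neq_vertices H).
- by rewrite kR !(neq_vertices H).
- move=> h hA; case: (dartP H hA) => -[i ip [] ->].
  + by case: i ip => // _; rewrite kL; apply: fconn_step; rewrite -/fn f0l connect0.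
  + case: i ip => // _; rewrite kL; apply: fconn_step; rewrite -/fn f0m.
    by apply: fconn_step; rewrite -/fn f0l connect0.
  + apply: fconn_step; rewrite -/fn (kinv (eR i, r) (fn (eR i, r)) (eqxx _)).
    rewrite /fn (face_R H) (fp_rhomR H); case: ifP => [_|_].
      rewrite kL; apply: fconn_step; rewrite -/fn f0m.
      by apply: fconn_step; rewrite -/fn f0l connect0.
    by apply: cR; rewrite //= (inc_eR H) eqxx.
  + by apply: cR; rewrite //= (inc_eR H) eqxx.
Qed.

(** * Labelling the edges *)

Lemma iter_eq_mod (T : finType) (f : T -> T) x i j : injective f ->
  (iter i f x == iter j f x) = (i == j %[mod order f x]).
Proof.
move=> fI; set o := order f x; have o0 : (0 < o)%N := order_gt0 f x.
have im k : iter k f x = iter (k %% o) f x.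
  rewrite {1}(divn_eq k o) addnC iterD; congr (iter _ f _).
  by elim: (k %/ o)%N => // n IH; rewrite mulSn iterD IH iter_order.
rewrite (im i) (im j); apply/eqP/eqP => [h|->] //.
by rewrite -(findex_iter (ltn_pmod i o0)) h findex_iter ?ltn_pmod.
Qed.

Section Labelling.
Variables (V E : finType) (s t : E -> V) (rho : V -> {perm E}).
Variables (l m r : V) (A : pred E) (cf cl : E).
Hypotheses (ribbon : is_ribbon s t rho) (lm : l != m) (rm : r != m) (lr : l != r).
Hypothesis V3 : forall y, [|| y == l, y == m | y == r].
Hypothesis endA : forall e, A e -> s e = m /\ t e = r.
Hypothesis endC : forall e, ~~ A e -> s e = l /\ t e = m.
Hypotheses (A0 : exists e, A e) (cfA : ~~ A cf) (clA : ~~ A cl).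
Hypothesis cE : forall e, ~~ A e -> e = cf \/ e = cl.
Hypothesis cons : cf = cl \/ rho m cf = cl.
Hypothesis restr : forall f, A f -> restrict_succ (rho m) A f (rho r f).

Lemma inc_label : (forall e, inc s t l e = ~~ A e) *
  (forall e, inc s t m e) * (forall e, inc s t r e = A e).
Proof.
split; [split|] => e; rewrite /inc; case: (boolP (A e)) => [/endA|/endC] [-> ->].
all: rewrite ?eqxx ?orbT //.
- by rewrite eq_sym (negbTE lm) eq_sym (negbTE lr).
- by rewrite (negbTE lr) eq_sym (negbTE rm).
Qed.

Lemma rho_fixed u e e' : rho u e = e -> inc s t u e -> inc s t u e' -> e' = e.
Proof.
move=> fix_e ie ie'; have [_ /(_ e e' ie ie') /iter_findex <-] := ribbon u.
by elim: (findex _ _ _) => //= n ->.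
Qed.

(** Otherwise the edges outside A would be stable under [rho m], which is a single cycle that also
    contains edges of A. *)
Lemma rho_m_last : A (rho m cl).
Proof.
apply: contraT => nA; case: A0 => f Af; case/negP: nA.
have stable e : ~~ A e -> ~~ A (rho m cl) -> ~~ A (rho m e).
  by case/cE => -> //; case: cons => ->.
have [_ /(_ cl f)] := ribbon m; rewrite !inc_label => /(_ isT isT) /iter_findex fE.
apply: contraLR Af => nA; rewrite -fE.
by elim: (findex _ _ _) => //= n IH; apply: stable.
Qed.

(** The next edge of A after f in [rho m] is [rho r f]. Either it follows at once, or the edges from
    cf to cl come in between, and then it is the edge after cl. *)
Lemma rho_m_A f : A f -> rho m f = if rho r f == rho m cl then cf else rho r f.
Proof.
move=> Af; have [Ar [k [k0 kE kn]]] := restr Af.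
case: (boolP (A (rho m f))) => Am.
  have k1 : k = 1%N.
    case: k k0 kE kn => [//|[//|k]] _ _ /(_ 1%N isT isT).
    by rewrite -topredE /= Am.
  move: kE; rewrite k1 /= => <-; rewrite (inj_eq perm_inj); case: eqP => // h.
  by rewrite h (negbTE clA) in Af.
have mE : rho m f = cf.
  case: (cE Am) => // h; case: cons => [->//|h']; rewrite -h' in h.
  by rewrite (perm_inj h) (negbTE cfA) in Af.
suff -> : rho r f = rho m cl by rewrite eqxx mE.
have Af0 := rho_m_last; rewrite -kE; rewrite -kE -topredE /= in Ar.
(* The excursion outside A is cf alone or cf then cl, so it returns to A at step 2 or 3. *)
case: k k0 kE kn Ar => [//|[|[|[|k]]]] _ kE kn /=.
- by rewrite mE (negbTE cfA).
- by rewrite mE; case: cons => [->//|->]; rewrite (negbTE clA).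
- rewrite mE; case: cons => [h|-> //]; have := kn 2 isT isT.
  by rewrite /= mE h -topredE /= Af0.
- case: cons => h; first by have := kn 2 isT isT; rewrite /= mE h -topredE /= Af0.
  by have := kn 3 isT isT; rewrite /= mE h -topredE /= Af0.
Qed.

Lemma rho_l_last : (rho l cf = cl) /\ (rho l cl = cf).
Proof.
have il := inc_label.
have inC e : ~~ A e -> ~~ A (rho l e) by rewrite -!il inc_rho.
have sw e e' : ~~ A e -> ~~ A e' -> rho l e = e -> e' = e.
  by rewrite -!il => ie ie' h; apply: rho_fixed h ie ie'.
case: (cE (inC _ cfA)) => h; case: (cE (inC _ clA)) => h'.
- by have -> := sw _ _ cfA clA h; split; rewrite // h.
- by have e := sw _ _ cfA clA h; rewrite e in h' *; rewrite h.
- by [].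
- by have e := sw _ _ clA cfA h'; rewrite e in h *; rewrite h.
Qed.

(** The r-edges are numbered along [rho r], starting with the edge that follows the l-block at m;
    [rho_m_A] shows that this is also their order at m. *)
Lemma fat_path_labelling : exists eL eR,
  fat_path s t rho l m r (if cf == cl then 1 else 2) #|A| eL eR.
Proof.
pose eL i := if odd i then cl else cf; pose eR i := iter i (rho r) (rho m cl).
have [il im ir] : [/\ forall e, inc s t l e = ~~ A e, forall e, inc s t m e
  & forall e, inc s t r e = A e] by split=> e; rewrite inc_label.
have Af0 := rho_m_last; have if0 : inc s t r (rho m cl) by rewrite ir.
have oE : order (rho r) (rho m cl) = #|A|.
  by apply: eq_card => e; rewrite -[LHS]/(fconnect _ _ e) fconnect_orbit (inc_orbit ribbon if0) inE ir.
have AR i : A (eR i).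
  by rewrite -ir; elim: i => //= i; rewrite -(inc_rho ribbon).
have CL i : ~~ A (eL i) by rewrite /eL; case: ifP.
have eqR i j : (eR i == eR j) = (i == j %[mod #|A|]).
  by rewrite -oE; apply/iter_eq_mod/perm_inj.
exists eL, eR; split=> //.
- by case: ifP.
- by rewrite -oE order_gt0.
- by move=> i; left; apply: endC.
- by move=> i; right; apply: endA.
- move=> e; case: (boolP (A e)) => [Ae|/cE ce]; [right | left].
    have c : fconnect (rho r) (rho m cl) e.
      by rewrite fconnect_orbit (inc_orbit ribbon if0) inE ir.
    by exists (findex (rho r) (rho m cl) e); rewrite -?oE ?findex_max // /eR iter_findex.
  case: (altP (cf =P cl)) ce => [<-|n] [->|->]; try by exists 0%N.
  by exists 1%N.
- move=> i j; rewrite /eL; case: (altP (cf =P cl)) => [<-|n]; first by rewrite !if_same !modn1 !eqxx.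
  rewrite !modn2; case: (odd i) (odd j) => [] []; rewrite ?eqxx //=.
    by rewrite eq_sym (negbTE n).
  by rewrite (negbTE n).
- by have [a b] := rho_l_last; move=> i; rewrite /eL /=; case: (odd i).
- move=> i; rewrite /eL /=; case: (altP (cf =P cl)) => [ee|n].
    by rewrite dvd1n ee if_same.
  rewrite dvdn2 /=; case: (odd i) => //=.
  by case: cons n => [->|//]; rewrite eqxx.
- move=> i; rewrite (rho_m_A (AR i)) -[rho r (eR i)]/(eR i.+1) -[rho m cl]/(eR 0%N) eqR.
  by rewrite mod0n.
Qed.

End Labelling.

(** * Comparison of the two graphs *)

Lemma modeq_crt n a b : odd n -> modeq n.*2 a b <-> modeq 2 a b /\ modeq n a b.
Proof.
move=> on; split=> [[k ->]|[[k kE] [h hE]]].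
  by split; [exists (k * n%:Z) | exists (k * 2)]; rewrite -muln2; lia.
have nE : n%:Z = 1 + 2 * (n./2)%:Z by have := odd_double_half n; rewrite on; lia.
(* The witness comes from the Bezout relation n - 2 * (n./2) = 1 multiplied by a - b. *)
exists (k - h * (n./2)%:Z); rewrite -muln2 PoszM; nia.
Qed.

Section Comparison.
Variables (V E E' : finType) (s t : E -> V) (s' t' : E' -> V).
Variables (rho : V -> {perm E}) (rho' : V -> {perm E'}).
Variables (l m r : V) (n : nat) (eL eR : nat -> E) (eL' eR' : nat -> E').
Hypothesis H : fat_path s t rho l m r 2 n eL eR.
Hypothesis H' : fat_path s' t' rho' l m r 1 n.*2 eL' eR'.
Hypothesis odd_n : odd n.

(* By the Chinese remainder theorem the trees of the first graph are those
   with coordinates (k mod 2, k mod n); they are sent to the tree with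
   coordinate k mod 2n. *)
Definition tree_map (T : {set E}) : {set E'} :=
  if [pick k : 'I_n.*2 | T == [set eL k; eR k]] is Some k then [set eL' 0; eR' k]
  else set0.

Lemma tree_inj i j i' j' : [set eL i; eR j] = [set eL i'; eR j'] ->
  modeq 2 i i' /\ modeq n j j'.
Proof.
have nRL a b : eR a == eL b = false.
  by apply/eqP => h; have := inc_eL H b l; rewrite -h (inc_eR H) !(neq_vertices H) eqxx.
move/setP => h.
have := h (eL i); rewrite !inE eqxx [eL i == eR j']eq_sym nRL orbF => /esym/eqP hL.
have := h (eR j); rewrite !inE eqxx orbT nRL => /esym/eqP hR.
by split; [apply/(eL_eq_modeq H) | apply/(eL_eq_modeq (fat_path_swap H))].
Qed.

Lemma tree_diag T : spanning_tree s t T -> exists k : nat, T = [set eL k; eR k].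
Proof.
move/(tree_coordsP H) => [i [j ->]].
have co : coprime 2 n by rewrite coprime2n.
exists (chinese 2 n i j); apply: (eq_tree H); apply/modeqP.
  by rewrite chinese_modl.
by rewrite chinese_modr.
Qed.

Lemma eR'_eq (k k' : nat) : modeq n.*2 k k' -> eR' k = eR' k'.
Proof. by move/(eL_eq_modeq (fat_path_swap H')). Qed.

Lemma eL'_eq (i j : nat) : eL' i = eL' j.
Proof. by apply/(eL_eq_modeq H'); exists (i%:Z - j%:Z); lia. Qed.

Lemma tree_mapE (k : nat) : tree_map [set eL k; eR k] = [set eL' 0; eR' k].
Proof.
rewrite /tree_map; case: pickP => [k' /eqP /tree_inj h|/(_ _) none].
  by congr [set _; _]; apply: eR'_eq; apply/modeq_sym/modeq_crt.
have lt : (k %% n.*2 < n.*2)%N by rewrite ltn_mod (fp_q H').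
have := none (Ordinal lt); rewrite /= => /eqP [].
have /(modeq_crt _ _ odd_n) [] : modeq n.*2 k (k %% n.*2)%N.
  by apply/modeqP; rewrite modn_mod.
by move=> a b; apply: (eq_tree H).
Qed.

Lemma tree_map_tree T : spanning_tree s t T -> spanning_tree s' t' (tree_map T).
Proof.
by move/tree_diag => [k ->]; rewrite tree_mapE; apply/(tree_coordsP H'); exists 0%N, k.
Qed.

Lemma tree_map_inj T1 T2 : spanning_tree s t T1 -> spanning_tree s t T2 ->
  tree_map T1 = tree_map T2 -> T1 = T2.
Proof.
move=> /tree_diag [k ->] /tree_diag [k' ->]; rewrite !tree_mapE => /setP/(_ (eR' k)).
rewrite !inE eqxx orbT => /esym/orP[/eqP h|/eqP h].
  by have := inc_eL H' 0%N l; rewrite -h (inc_eR H') !(neq_vertices H) eqxx.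
have /(modeq_crt _ _ odd_n) [a b] : modeq n.*2 k k' by apply/(eL_eq_modeq (fat_path_swap H')).
exact: (eq_tree H).
Qed.

Lemma tree_map_surj T' : spanning_tree s' t' T' -> exists T, spanning_tree s t T /\ tree_map T = T'.
Proof.
move/(tree_coordsP H') => [i [j ->]]; exists [set eL j; eR j]; split.
  by apply/(tree_coordsP H); exists j, j.
by rewrite tree_mapE (eL'_eq i 0).
Qed.

(** Diagonal coordinates (k, k) stay diagonal because the two shifts agree modulo 2; the
    l-coordinate modulo 1 carries no condition. *)
Lemma coords_compare (a c : int) (k k' : nat) (P Q : Prop) : modeq 2 a c ->
  (P <-> modeq 2 k' (k%:Z + a) /\ modeq n k' (k%:Z + c)) ->
  (Q <-> modeq 1 0%N (0%N%:Z + a) /\ modeq n.*2 k' (k%:Z + c)) -> P <-> Q.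
Proof.
move=> [x ->] -> ->; rewrite modeq_crt //; split=> [[[y hy] h]|[_ [[y hy] h]]].
  by split; [exists (- c - x * 2); lia | split=> //; exists (y + x); lia].
by split=> //; exists (y - x); lia.
Qed.

Lemma routing_compare u D T T1 : deg D = 0 -> D m = 0 ->
  spanning_tree s t T -> spanning_tree s t T1 ->
  (rotor_rel s t rho u D T T1 <->
   rotor_rel s' t' rho' u D (tree_map T) (tree_map T1)) /\
  (bern_rel s t rho u D T T1 <->
   bern_rel s' t' rho' u D (tree_map T) (tree_map T1)).
Proof.
move=> D0 Dm /tree_diag [k ->] /tree_diag [k' ->]; rewrite !tree_mapE.
have Dlr : D l = - D r by move: D0; rewrite /deg (sum_V H) Dm; lia.
have Hs := fat_path_swap H; have Hs' := fat_path_swap H'.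
(* As D l = - D r, all four choices of signs give shifts of the same parity. *)
have pm (x y : int) : (x = D l \/ x = - D l) -> (y = D r \/ y = - D r) -> modeq 2 x y.
  rewrite Dlr => -[] -> [] ->; first by exists (- D r); lia.
  - by exists 0; lia.
  - by exists 0; lia.
  - by exists (D r); lia.
case/or3P: (fp_V H u) => /eqP ->.
- split.
    by apply: (coords_compare (a := - D l) (c := D r)) (rotor_rel_l H _ _ _ _ D0) (rotor_rel_l H' _ _ _ _ D0); auto.
  by apply: (coords_compare (a := D l) (c := - D r)) (bern_rel_l H _ _ _ _ D0) (bern_rel_l H' _ _ _ _ D0); auto.
- split.
    by apply: (coords_compare (a := D l) (c := D r)) (rotor_rel_m H _ _ _ _ D0) (rotor_rel_m H' _ _ _ _ D0); auto.
  by apply: (coords_compare (a := - D l) (c := - D r)) (bern_rel_m H _ _ _ _ D0) (bern_rel_m H' _ _ _ _ D0); auto.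
(* Root r is root l of the path read backwards, with the two coordinates exchanged. *)
- rewrite ![_ |: [set eR _]]setUC ![_ |: [set eR' _]]setUC; split.
    apply: (coords_compare (a := D l) (c := - D r) (k := k) (k' := k')); first by auto.
      by have := rotor_rel_l Hs k k k' k' D0; tauto.
    by have := rotor_rel_l Hs' k 0 k' 0 D0; tauto.
  apply: (coords_compare (a := - D l) (c := D r) (k := k) (k' := k')); first by auto.
    by have := bern_rel_l Hs k k k' k' D0; tauto.
  by have := bern_rel_l Hs' k 0 k' 0 D0; tauto.
Qed.

Variable Vg : pred V.
Hypothesis VgE : forall y, (y \notin Vg) = (y == m).

Lemma property1_double : property1 s t Vg.
Proof.
(* Since n is odd, c is congruent to D r modulo n and to D l modulo 2, and so is - c modulo 2. *)
move=> D degD; pose c := D r + n%:Z * (D r + D l).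
pose D' y := if y == r then c else if y == l then - c else 0.
have [D'l D'm D'r] : [/\ D' l = - c, D' m = 0 & D' r = c].
  by rewrite /D' !eqxx !(neq_vertices H).
exists D'; split=> [|y]; last by rewrite VgE => /eqP ->.
apply/(lin_equivP H); rewrite degD D'l D'r; split.
- by rewrite /deg (sum_V H) D'l D'm D'r; lia.
- have nE : n%:Z = 1 + 2 * (n./2)%:Z by have := odd_double_half n; rewrite odd_n; lia.
  by exists (- D r - D l - (n./2)%:Z * (D r + D l)); rewrite /c nE; lia.
- by exists (D r + D l); rewrite /c; lia.
Qed.

Lemma property1_bridge : property1 s' t' Vg.
Proof.
clear odd_n; move=> D degD; pose D' y := if y == r then D r else if y == l then - D r else 0.
have [D'l D'm D'r] : [/\ D' l = - D r, D' m = 0 & D' r = D r].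
  by rewrite /D' !eqxx !(neq_vertices H').
exists D'; split=> [|y]; last by rewrite VgE => /eqP ->.
apply/(lin_equivP H'); rewrite degD D'l D'r; split.
- by rewrite /deg (sum_V H') D'l D'm D'r; lia.
- by exists (- D r - D l); lia.
- exact: modeq_refl.
Qed.

(** A degree-zero divisor without chips at m is determined by D r, and equivalence in the first
    graph compares D r modulo 2 and modulo n, that is modulo 2n. *)
Lemma property2_compare : property2 s t s' t' Vg.
Proof.
move=> D1 D2 d1 d2 v1 v2; rewrite (lin_equivP H) (lin_equivP H').
have crt := modeq_crt (D2 r) (D1 r) odd_n.
have Dl D : deg D = 0 -> (forall y, y \notin Vg -> D y = 0) -> D l = - D r.
  by move=> + v; rewrite /deg (sum_V H) [D m]v ?VgE // => ?; lia.
rewrite (Dl _ d1 v1) (Dl _ d2 v2).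
split=> -[e [a ha] b]; split=> //.
- by exists (- D2 r + D1 r); lia.
- by apply/crt; split=> //; exists (- a); lia.
- by case/crt: b => -[b hb] _; exists (- b); lia.
- by case/crt: b.
Qed.

End Comparison.

(** * The two given ribbon graphs *)

Unset Implicit Arguments.

Theorem theorem3p7 (g : nat) (gpos : (0 < g)%N)
  (rho : 'I_3 -> {perm EG g}) (rho' : 'I_3 -> {perm EG' g}) :
  is_ribbon (@srcG g) (@tgtG g) rho ->
  (rho zz (c1 g) = c2 g \/ rho zz (c2 g) = c1 g) ->
  (forall f : EG g, isF f -> restrict_succ (rho zz) (@isF g) f (rho ww f)) ->
  is_ribbon (@srcG' g) (@tgtG' g) rho' ->
  (forall h : EG' g, isH h -> restrict_succ (rho' zz) (@isH g) h (rho' ww h)) ->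
  [/\ property1 (@srcG g) (@tgtG g) Vgen,
      property1 (@srcG' g) (@tgtG' g) Vgen,
      property2 (@srcG g) (@tgtG g) (@srcG' g) (@tgtG' g) Vgen,
      (exists phi : {set EG g} -> {set EG' g},
        [/\ forall T, spanning_tree (@srcG g) (@tgtG g) T ->
                      spanning_tree (@srcG' g) (@tgtG' g) (phi T),
            forall T1 T2, spanning_tree (@srcG g) (@tgtG g) T1 ->
                      spanning_tree (@srcG g) (@tgtG g) T2 -> phi T1 = phi T2 -> T1 = T2,
            forall T', spanning_tree (@srcG' g) (@tgtG' g) T' ->
                      (exists T, spanning_tree (@srcG g) (@tgtG g) T /\ phi T = T') &
            forall (u : 'I_3) (D : 'I_3 -> int) (T T1 : {set EG g}),
              deg D = 0 -> (forall y, y \notin Vgen -> D y = 0) ->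
              spanning_tree (@srcG g) (@tgtG g) T ->
              spanning_tree (@srcG g) (@tgtG g) T1 ->
              (rotor_rel (@srcG g) (@tgtG g) rho u D T T1 <->
               rotor_rel (@srcG' g) (@tgtG' g) rho' u D (phi T) (phi T1)) /\
              (bern_rel (@srcG g) (@tgtG g) rho u D T T1 <->
               bern_rel (@srcG' g) (@tgtG' g) rho' u D (phi T) (phi T1))])
      & twice_genus (@srcG g) (@tgtG g) rho = (2 * g)%:Z /\
      twice_genus (@srcG' g) (@tgtG' g) rho' = (2 * (2 * g))%:Z].
Proof.
move=> rib cc hF rib' hH.
have V3 (y : 'I_3) : [|| y == vv, y == zz | y == ww].
  by case: y => -[|[|[|//]]] ?; rewrite -!val_eqE.
have endF (e : EG g) : isF e -> srcG e = zz /\ tgtG e = ww.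
  by rewrite /isF /srcG /tgtG [(e < 2)%N]ltnNge => ->.
have endC (e : EG g) : ~~ isF e -> srcG e = vv /\ tgtG e = zz.
  by rewrite /isF /srcG /tgtG -ltnNge => ->.
have endH (e : EG' g) : isH e -> srcG' e = zz /\ tgtG' e = ww.
  by rewrite /isH /srcG' /tgtG' lt0n => /negbTE ->.
have endC' (e : EG' g) : ~~ isH e -> srcG' e = vv /\ tgtG' e = zz.
  by rewrite /isH /srcG' /tgtG' -eqn0Ngt => ->.
have cardF : #|@isF g| = g.*2.+1.
  rewrite -sum1_card big_mkcond !big_ord_recl /= add0n add0n.
  by rewrite (eq_bigr (fun=> 1%N)) // sum_nat_const card_ord muln1.
have cardH : #|@isH g| = g.*2.+1.*2.
  rewrite -sum1_card big_mkcond !big_ord_recl /= add0n.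
  by rewrite (eq_bigr (fun=> 1%N)) // sum_nat_const card_ord muln1.
have exF : exists e : EG g, isF e.
  have lt : (2 < g.*2.+1.+2)%N by lia.
  by exists (Ordinal lt).
have exH : exists e : EG' g, isH e by exists ord_max.
have c12 e : ~~ @isF g e -> e = c1 g \/ e = c2 g.
  by rewrite /isF -ltnNge; case: e => -[|[|//]] ? _; [left | right]; apply: val_inj.
have cE' e : ~~ @isH g e -> e = ord0 \/ e = ord0.
  by rewrite /isH -eqn0Ngt => /eqP e0; left; apply: val_inj.
have [eL [eR H]] : exists eL eR, fat_path (@srcG g) (@tgtG g) rho vv zz ww 2 g.*2.+1 eL eR.
  have n12 : (c1 g == c2 g) = false by [].
  have n21 : (c2 g == c1 g) = false by [].
  (* Whichever of the two parallel edges comes first in [rho zz] plays the role of [cf]. *)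
  case: cc => cc.
    have := fat_path_labelling (l := vv) (m := zz) (r := ww) rib isT isT isT V3 endF endC exF (cf := c1 g) (cl := c2 g) isT isT c12 (or_intror cc) hF.
    by rewrite n12 cardF.
  have c21 e : ~~ @isF g e -> e = c2 g \/ e = c1 g by move/c12/or_comm.
  have := fat_path_labelling (l := vv) (m := zz) (r := ww) rib isT isT isT V3 endF endC exF (cf := c2 g) (cl := c1 g) isT isT c21 (or_intror cc) hF.
  by rewrite n21 cardF.
have [eL' [eR' H']] : exists eL eR, fat_path (@srcG' g) (@tgtG' g) rho' vv zz ww 1 g.*2.+1.*2 eL eR.
  have := fat_path_labelling (l := vv) (m := zz) (r := ww) rib' isT isT isT V3 endH endC' exH (cf := ord0) (cl := ord0) isT isT cE' (or_introl erefl) hH.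
  by rewrite eqxx cardH.
have on : odd g.*2.+1 by rewrite /= odd_double.
have VgE (y : 'I_3) : (y \notin Vgen) = (y == zz).
  by case: y => -[|[|[|//]]] ?; rewrite unfold_in /= -!val_eqE.
split.
- exact (property1_double H on VgE).
- exact (property1_bridge H' VgE).
- exact (property2_compare H H' on VgE).
- exists (tree_map g.*2.+1 eL eR eL' eR'); split.
  + exact: tree_map_tree H H' on.
  + exact: tree_map_inj H H' on.
  + exact: tree_map_surj H H' on.
  + move=> u D T T1 D0 Dv; apply: (routing_compare H H' on) => //.
    by apply: Dv; rewrite VgE.
- rewrite /twice_genus (ncycles_double H on) ?(ncycles_bridge H') ?odd_double //; last first.
    by lia.
  by rewrite !card_ord; split; lia.
Qed.
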